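(* Assume $2^{\omega}<\aleph_\omega$. The following are equivalent: (1) $\aleph_\omega$ is Jonsson; (2) there exists an I3 tower of height $\aleph_\omega$ that decides its critical sequence and is a canonical projection of NS. (The hypothesis $2^\omega<\aleph_\omega$ is only needed for (1)$\Rightarrow$(2).)
   Context: **Jonsson.** $\aleph_\omega$ is Jonsson if every structure on $\aleph_\omega$ in a countable language has a proper elementary substructure of cardinality $\aleph_\omega$. **Towers of normal ideals.** A tower of normal ideals of height $\lambda$ is $\langle I_x:x\in V_\lambda\rangle$ with each $I_x$ a normal, fine, countably complete ideal on $\wp(x)$ and, for $x\subseteq y$, $A\in I_x\iff\{M\subseteq y:M\cap x\in A\}\in I_y$. Its forcing $\mathbb B_{\vec I}$ (positive sets ordered modulo the ideals) produces a generic ultrapower $j_{\dot G}$. **I3 towers and critical sequences.** An I3 tower is such a tower with $\mathrm{cf}(\lambda)=\omega$ such that $\mathbb B_{\vec I}$ forces the critical sequence of $j_{\dot G}$ to be contained in and cofinal in $\lambda$. The tower decides its critical sequence if there is a ground-model sequence $\vec\kappa=\langle\kappa_n:n\in\omega\rangle$ that $\mathbb B_{\vec I}$ forces to be the critical sequence of $j_{\dot G}$. **Canonical projection of NS.** The tower is a canonical projection of NS if there is a stationary set $S$ with $V_\lambda\subseteq\bigcup S$ such that for all $x\in V_\lambda$ and $A\subseteq\wp(x)$: $A\in I_x\iff\{M\in S:M\cap x\in A\}$ is nonstationary. Here $S$ is stationary if every $f:[\bigcup S]^{<\omega}\to\bigcup S$ has a closure point in $S$. *)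

(* Defs.v *)
From Stdlib Require Import Classical ClassicalEpsilon FunctionalExtensionality
  PropExtensionality Wf_nat Arith List Fin.

Set Implicit Arguments.
Unset Strict Implicit.

(** * The universe of sets

    Aczel's trees over [Type], quotiented by bisimilarity so that equality of
    sets is Leibniz equality.  With classical logic and choice this is a model
    of ZFC (with replacement and separation for all Rocq functions and
    predicates), so a Rocq function [V -> V] restricted to a set is a function
    in the sense of set theory. *)

Inductive pset : Type := psup (A : Type) (f : A -> pset).

Fixpoint peq (x y : pset) : Prop :=
  match x, y with
  | psup f, psup g =>
      (forall a, exists b, peq (f a) (g b)) /\
      (forall b, exists a, peq (f a) (g b))
  end.

Lemma peq_refl x : peq x x.
Proof. induction x as [A f IH]; simpl; split; intro a; exists a; apply IH. Qed.

Lemma peq_sym x y : peq x y -> peq y x.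
Proof.
  revert y; induction x as [A f IH]; intros [B g]; simpl; intros [H1 H2].
  split; [intro b; destruct (H2 b) as [a Ha] | intro a; destruct (H1 a) as [b Ha]];
    eexists; apply IH; exact Ha.
Qed.

Lemma peq_trans x y z : peq x y -> peq y z -> peq x z.
Proof.
  revert y z; induction x as [A f IH]; intros [B g] [C h]; simpl.
  intros [H1 H2] [K1 K2]; split.
  - intro a; destruct (H1 a) as [b Hb]; destruct (K1 b) as [c Hc].
    exists c; exact (IH _ _ _ Hb Hc).
  - intro c; destruct (K2 c) as [b Hb]; destruct (H2 b) as [a Ha].
    exists a; exact (IH _ _ _ Ha Hb).
Qed.

Definition pcanon (x : pset) : pset :=
  epsilon (inhabits (psup (fun e : False => match e with end))) (peq x).

Lemma peq_pcanon x : peq x (pcanon x).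
Proof. unfold pcanon; apply epsilon_spec; exists x; apply peq_refl. Qed.

Lemma pcanon_eq x y : peq x y -> pcanon x = pcanon y.
Proof.
  intro H; unfold pcanon; f_equal; apply functional_extensionality; intro z.
  apply propositional_extensionality; split; intro K.
  - exact (peq_trans (peq_sym H) K).
  - exact (peq_trans H K).
Qed.

Lemma pcanon_idem x : pcanon (pcanon x) = pcanon x.
Proof. symmetry; apply pcanon_eq, peq_pcanon. Qed.

Definition V : Type := {x : pset | pcanon x = x}.

Definition class_of (x : pset) : V := exist _ (pcanon x) (pcanon_idem x).

Lemma V_eq (x y : V) : peq (proj1_sig x) (proj1_sig y) -> x = y.
Proof.
  destruct x as [x hx], y as [y hy]; simpl; intro H.
  assert (E : x = y) by (rewrite <- hx, <- hy; apply pcanon_eq, H).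
  subst y; f_equal; apply proof_irrelevance.
Qed.

Definition mem (x y : V) : Prop :=
  match proj1_sig y with psup g => exists b, peq (proj1_sig x) (g b) end.

Declare Scope set_scope.
Delimit Scope set_scope with set.
Open Scope set_scope.

Notation "x ∈ y" := (mem x y) (at level 70, no associativity) : set_scope.
Notation "x ∉ y" := (~ mem x y) (at level 70, no associativity) : set_scope.

Definition subset (x y : V) : Prop := forall z, z ∈ x -> z ∈ y.
Notation "x ⊆ y" := (subset x y) (at level 70, no associativity) : set_scope.

(** The set of all [f a], for [a] in a small type [A]. *)
Definition mkset (A : Type) (f : A -> V) : V :=
  class_of (psup (fun a => proj1_sig (f a))).

Lemma mem_mkset (A : Type) (f : A -> V) x : x ∈ mkset f <-> exists a, x = f a.
Proof.
  unfold mem, mkset; simpl.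
  pose proof (peq_pcanon (psup (fun a => proj1_sig (f a)))) as H.
  destruct (pcanon _) as [B g]; simpl in H; destruct H as [H1 H2]; split.
  - intros [b Hb]; destruct (H2 b) as [a Ha]; exists a; apply V_eq.
    exact (peq_trans Hb (peq_sym Ha)).
  - intros [a ->]; exact (H1 a).
Qed.

(** Every set is the image of a small type. *)
Lemma mkset_surj (x : V) : exists (A : Type) (f : A -> V), x = mkset f.
Proof.
  destruct x as [[A f] hx]; exists A, (fun a => class_of (f a)).
  apply V_eq; unfold mkset, class_of; cbn [proj1_sig].
  eapply peq_trans; [| apply peq_pcanon]; simpl.
  split; intro a; exists a; apply peq_pcanon.
Qed.

Lemma set_ext (x y : V) : (forall z, z ∈ x <-> z ∈ y) -> x = y.
Proof.
  destruct (mkset_surj x) as (A & f & ->), (mkset_surj y) as (B & g & ->).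
  intro H; apply V_eq; unfold mkset, class_of; cbn [proj1_sig].
  eapply peq_trans; [apply peq_sym, peq_pcanon |].
  eapply peq_trans; [| apply peq_pcanon]; simpl; split.
  - intro a; assert (K : f a ∈ mkset g) by (apply H, mem_mkset; eauto).
    apply mem_mkset in K; destruct K as [b ->]; exists b; apply peq_refl.
  - intro b; assert (K : g b ∈ mkset f) by (apply H, mem_mkset; eauto).
    apply mem_mkset in K; destruct K as [a ->]; exists a; apply peq_refl.
Qed.

Lemma mem_wf : well_founded mem.
Proof.
  assert (H : forall p (x : V), peq (proj1_sig x) p -> Acc mem x).
  { induction p as [A f IH]; intros x Hx; constructor; intros y Hy.
    unfold mem in Hy; destruct (proj1_sig x) as [B g]; simpl in Hx.
    destruct Hx as [H1 _], Hy as [b Hb], (H1 b) as [a Ha].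
    apply (IH a); exact (peq_trans Hb Ha). }
  intro x; exact (H (proj1_sig x) x (peq_refl _)).
Qed.

(** * Comprehension *)

Definition small (P : V -> Prop) : Prop := exists x, forall y, y ∈ x <-> P y.

(** [set_of P] is [{y | P y}] when this is a set, junk otherwise; every use
    below comes with a proof of smallness. *)
Definition set_of (P : V -> Prop) : V :=
  epsilon (inhabits (mkset (fun e : False => match e with end)))
    (fun x => forall y, y ∈ x <-> P y).

Lemma mem_set_of P y : small P -> (y ∈ set_of P <-> P y).
Proof. intro H; unfold set_of; revert y; apply epsilon_spec; exact H. Qed.

Lemma small_image (A : Type) (f : A -> V) (P : V -> Prop) :
  (forall y, P y -> exists a, y = f a) -> small P.
Proof.
  intro H; exists (mkset (fun a : {a | P (f a)} => f (proj1_sig a))); intro y.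
  rewrite mem_mkset; split.
  - intros [[a Ha] ->]; exact Ha.
  - intro Hy; destruct (H y Hy) as [a ->]; exists (exist _ a Hy); reflexivity.
Qed.

Definition sep (x : V) (P : V -> Prop) : V := set_of (fun y => y ∈ x /\ P y).

Lemma mem_sep x P y : y ∈ sep x P <-> y ∈ x /\ P y.
Proof.
  unfold sep; rewrite mem_set_of; [reflexivity |]; destruct (mkset_surj x) as (A & f & ->).
  apply small_image with (f := f); intros z [Hz _]; apply mem_mkset, Hz.
Qed.

Definition empty : V := set_of (fun _ => False).

Lemma mem_empty y : y ∈ empty <-> False.
Proof.
  unfold empty; rewrite mem_set_of; [reflexivity |]; apply small_image with (f := fun e : False => match e with end).
  tauto.
Qed.

Definition power (x : V) : V := set_of (fun y => y ⊆ x).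

Lemma mem_power x y : y ∈ power x <-> y ⊆ x.
Proof.
  unfold power; rewrite mem_set_of; [reflexivity |]; destruct (mkset_surj x) as (A & f & ->).
  apply small_image with
    (f := fun Q : A -> Prop => mkset (fun a : {a | Q a} => f (proj1_sig a))).
  intros z Hz; exists (fun a => f a ∈ z); apply set_ext; intro w.
  rewrite mem_mkset; split.
  - intro Hw; destruct (proj1 (mem_mkset _ _) (Hz _ Hw)) as [a ->].
    exists (exist _ a Hw); reflexivity.
  - intros [[a Ha] ->]; exact Ha.
Qed.

(** [bigcup F] is the union of a small family of sets. *)
Definition bigcup (A : Type) (F : A -> V) : V :=
  set_of (fun y => exists a, y ∈ F a).

Lemma mem_bigcup (A : Type) (F : A -> V) y : y ∈ bigcup F <-> exists a, y ∈ F a.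
Proof.
  unfold bigcup; rewrite mem_set_of; [reflexivity |].
  assert (C : forall a, exists Bf : {B : Type & B -> V}, F a = mkset (projT2 Bf)).
  { intro a; destruct (mkset_surj (F a)) as (B & f & E); exists (existT _ B f); exact E. }
  pose (c a := proj1_sig (constructive_indefinite_description _ (C a))).
  apply small_image with (f := fun ab : {a : A & projT1 (c a)} =>
    projT2 (c (projT1 ab)) (projT2 ab)).
  intros z [a Hz].
  assert (E : F a = mkset (projT2 (c a)))
    by exact (proj2_sig (constructive_indefinite_description _ (C a))).
  rewrite E in Hz; apply mem_mkset in Hz; destruct Hz as [b ->].
  exists (existT _ a b); reflexivity.
Qed.

Definition union (x : V) : V := set_of (fun y => exists z, z ∈ x /\ y ∈ z).

Lemma mem_union x y : y ∈ union x <-> exists z, z ∈ x /\ y ∈ z.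
Proof.
  unfold union; rewrite mem_set_of; [reflexivity |]; destruct (mkset_surj x) as (A & f & ->).
  exists (bigcup f); intro w; rewrite mem_bigcup; split.
  - intros [a Ha]; exists (f a); split; [apply mem_mkset; eauto | exact Ha].
  - intros (z & Hz & Hw); apply mem_mkset in Hz; destruct Hz as [a ->]; eauto.
Qed.

Definition cup (x y : V) : V := set_of (fun z => z ∈ x \/ z ∈ y).
Notation "x ∪ y" := (cup x y) (at level 50, left associativity) : set_scope.

Lemma mem_cup x y z : z ∈ x ∪ y <-> z ∈ x \/ z ∈ y.
Proof.
  unfold cup; rewrite mem_set_of; [reflexivity |]; exists (bigcup (fun b : bool => if b then x else y)).
  intro w; rewrite mem_bigcup; split.
  - intros [[|] H]; auto.
  - intros [H|H]; [exists true | exists false]; exact H.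
Qed.

Definition cap (x y : V) : V := sep x (fun z => z ∈ y).
Notation "x ∩ y" := (cap x y) (at level 40, left associativity) : set_scope.

Lemma mem_cap x y z : z ∈ x ∩ y <-> z ∈ x /\ z ∈ y.
Proof. unfold cap; rewrite mem_sep; reflexivity. Qed.

Definition Elt (x : V) : Type := {y : V | y ∈ x}.

(** [stage a] is $V_a = \bigcup_{b \in a} \wp(V_b)$. *)
Definition stage : V -> V :=
  Fix mem_wf (fun _ => V) (fun a rec =>
    set_of (fun x => exists (b : V) (hb : b ∈ a), x ⊆ rec b hb)).

Lemma mem_stage a x : x ∈ stage a <-> exists b, b ∈ a /\ x ⊆ stage b.
Proof.
  unfold stage at 1; rewrite Fix_eq.
  2:{ intros y f g H; f_equal; apply functional_extensionality; intro z.
      apply propositional_extensionality.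
      split; intros (b & hb & K); exists b, hb;
        [rewrite <- H | rewrite H]; exact K. }
  fold stage; rewrite mem_set_of.
  - split; [intros (b & hb & K) | intros (b & hb & K)]; eauto.
  - destruct (mkset_surj a) as (A & f & ->).
    exists (bigcup (fun i => power (stage (f i)))); intro y; rewrite mem_bigcup; split.
    + intros [i Hi]; apply mem_power in Hi; exists (f i).
      exists (proj2 (mem_mkset f (f i)) (ex_intro _ i eq_refl)); exact Hi.
    + intros (b & hb & K); destruct (proj1 (mem_mkset _ _) hb) as [i ->].
      exists i; apply mem_power, K.
Qed.

(** * Ordinals and cardinals *)

Definition transitive_set (x : V) : Prop := forall y, y ∈ x -> y ⊆ x.

Definition ordinal (x : V) : Prop :=
  transitive_set x /\ forall y, y ∈ x -> transitive_set y.

Fixpoint ofnat (n : nat) : V :=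
  match n with
  | 0 => empty
  | S m => set_of (fun y => y ∈ ofnat m \/ y = ofnat m)
  end.

Lemma mem_ofnat_S n y : y ∈ ofnat (S n) <-> y ∈ ofnat n \/ y = ofnat n.
Proof.
  simpl; rewrite mem_set_of; [reflexivity |]; exists (ofnat n ∪ mkset (fun _ : unit => ofnat n)).
  intro z; rewrite mem_cup, mem_mkset; split; (intros [H|H]; [left; exact H | right]).
  - destruct H as [_ H]; exact H.
  - exists tt; exact H.
Qed.

Definition omega : V := mkset ofnat.

Definition injects (x y : V) : Prop :=
  exists f : V -> V,
    (forall a, a ∈ x -> f a ∈ y) /\
    (forall a b, a ∈ x -> b ∈ x -> f a = f b -> a = b).

Definition equinumerous (x y : V) : Prop :=
  exists f : V -> V,
    (forall a, a ∈ x -> f a ∈ y) /\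
    (forall a b, a ∈ x -> b ∈ x -> f a = f b -> a = b) /\
    (forall b, b ∈ y -> exists a, a ∈ x /\ f a = b).

Definition card_lt (x y : V) : Prop := injects x y /\ ~ injects y x.

(** The Hartogs number of [k], which is $k^+$ when [k] is an infinite
    cardinal. *)
Definition card_succ (k : V) : V := set_of (fun a => ordinal a /\ injects a k).

Lemma mem_card_succ k a : a ∈ card_succ k <-> ordinal a /\ injects a k.
Proof.
  unfold card_succ; rewrite mem_set_of; [reflexivity |]; destruct (mkset_surj k) as (A & e & ->).
  pose (code := fun (R : A -> A -> Prop) (a : V) => ordinal a /\ exists g : V -> V,
    (forall b, b ∈ a -> exists i, g b = e i) /\
    (forall b c, b ∈ a -> c ∈ a -> g b = g c -> b = c) /\
    (forall i j, R i j <-> exists b c, b ∈ a /\ c ∈ a /\ (b ∈ c \/ b = c) /\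
                             e i = g b /\ e j = g c)).
  assert (half : forall R a a', code R a -> code R a' -> a ⊆ a').
  { intros R a1 a2 [[T1 _] (g1 & r1 & i1 & R1)] [[T2 _] (g2 & r2 & i2 & R2)].
    assert (irr : forall x : V, x ∉ x).
    { intro x; induction (mem_wf x) as [x _ IH]; intro h; exact (IH x h h). }
    assert (K : forall b, b ∈ a1 -> forall b', b' ∈ a2 -> g1 b = g2 b' -> b = b').
    { intro b; induction (mem_wf b) as [b _ IH]; intros hb b' hb' E.
      destruct (r1 b hb) as [j Ej]; apply set_ext; intro c; split; intro hc.
      - assert (hc1 : c ∈ a1) by (apply (T1 b hb), hc).
        destruct (r1 c hc1) as [i Ei].
        assert (Rij : R i j).
        { apply R1; exists c, b; repeat split; auto. }
        apply R2 in Rij; destruct Rij as (c' & d' & hc' & hd' & O & E1 & E2).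
        assert (d' = b') by (apply i2; auto; congruence); subst d'.
        assert (c = c') by (apply IH; auto; congruence); subst c'.
        destruct O as [O|O]; [exact O | subst c].
        exfalso; apply (irr b).
        assert (b' = b) by (apply i1; auto; congruence); subst b'; exact hc.
      - assert (hc2 : c ∈ a2) by (apply (T2 b' hb'), hc).
        destruct (r2 c hc2) as [i Ei].
        assert (Rij : R i j).
        { apply R2; exists c, b'; repeat split; auto; congruence. }
        apply R1 in Rij; destruct Rij as (c' & d' & hc' & hd' & O & E1 & E2).
        assert (d' = b) by (apply i1; auto; congruence); subst d'.
        destruct O as [O|O].
        + assert (c' = c) by (apply IH; auto; congruence); subst c'; exact O.
        + subst c'; exfalso; apply (irr b').
          assert (c = b') by (apply i2; auto; congruence); subst c; exact hc. }
    intros b hb; destruct (r1 b hb) as [i Ei].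
    assert (Rii : R i i) by (apply R1; exists b, b; repeat split; auto).
    apply R2 in Rii; destruct Rii as (b' & _ & hb' & _ & _ & E1 & _).
    assert (b = b') by (apply K; auto; congruence); subst b'; exact hb'. }
  apply small_image with (f := fun R => epsilon (inhabits empty) (code R)).
  intros b [ob (g & r & i)].
  pose (R := fun i j => exists b' c, b' ∈ b /\ c ∈ b /\ (b' ∈ c \/ b' = c) /\
                             e i = g b' /\ e j = g c).
  assert (C : code R b).
  { split; [exact ob | exists g; repeat split; auto].
    intros c hc; destruct (proj1 (mem_mkset _ _) (r c hc)) as [j Ej]; exists j; exact Ej. }
  exists R.
  assert (C' : code R (epsilon (inhabits empty) (code R)))
    by (apply epsilon_spec; exists b; exact C).
  apply set_ext; intro z; split; [apply (half R _ _ C C') | apply (half R _ _ C' C)].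
Qed.

Fixpoint aleph (n : nat) : V :=
  match n with
  | 0 => omega
  | S m => card_succ (aleph m)
  end.

Definition aleph_omega : V := bigcup aleph.

Definition cofinal_map (a l : V) (f : V -> V) : Prop :=
  (forall x, x ∈ a -> f x ∈ l) /\
  (forall b, b ∈ l -> exists x, x ∈ a /\ b ⊆ f x).

(** [is_cf l k]: [k] is the cofinality of the ordinal [l]. *)
Definition is_cf (l k : V) : Prop :=
  ordinal l /\ ordinal k /\
  (exists f, cofinal_map k l f) /\
  (forall a, a ∈ k -> ~ exists f, cofinal_map a l f).

(** * First-order structures and Jonsson cardinals *)

Record language : Type := Language {
  fsym : Type;
  farity : fsym -> nat;
  rsym : Type;
  rarity : rsym -> nat
}.

Definition countable_type (T : Type) : Prop :=
  exists c : T -> nat, forall x y, c x = c y -> x = y.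

Definition countable_language (L : language) : Prop :=
  countable_type (fsym L) /\ countable_type (rsym L).

Inductive term (L : language) : Type :=
| Var (n : nat)
| App (f : fsym L) (args : Fin.t (farity f) -> term L).

Inductive formula (L : language) : Type :=
| Equal (t u : term L)
| Rel (r : rsym L) (args : Fin.t (rarity r) -> term L)
| Bot
| Imp (phi psi : formula L)
| All (n : nat) (phi : formula L).

Record structure (L : language) (D : Type) : Type := Structure {
  fun_int : forall f : fsym L, (Fin.t (farity f) -> D) -> D;
  rel_int : forall r : rsym L, (Fin.t (rarity r) -> D) -> Prop
}.

Definition update (D : Type) (s : nat -> D) (n : nat) (d : D) : nat -> D :=
  fun m => if Nat.eqb m n then d else s m.

Fixpoint eval (L : language) (D : Type) (M : structure L D) (s : nat -> D)
    (t : term L) : D :=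
  match t with
  | Var _ n => s n
  | App args => fun_int M (fun i => eval M s (args i))
  end.

Fixpoint sat (L : language) (D : Type) (M : structure L D) (s : nat -> D)
    (phi : formula L) : Prop :=
  match phi with
  | Equal t u => eval M s t = eval M s u
  | Rel args => rel_int M (fun i => eval M s (args i))
  | Bot _ => False
  | Imp p q => sat M s p -> sat M s q
  | All n p => forall d : D, sat M (update s n d) p
  end.

Definition closed_under (L : language) (D : Type) (M : structure L D)
    (N : D -> Prop) : Prop :=
  forall (f : fsym L) (v : Fin.t (farity f) -> D),
    (forall i, N (v i)) -> N (fun_int M v).

Definition substructure (L : language) (D : Type) (M : structure L D)
    (N : D -> Prop) (H : closed_under M N) : structure L {d : D | N d} :=
  {| fun_int := fun f v =>
       exist N (fun_int M (fun i => proj1_sig (v i))) (H f _ (fun i => proj2_sig (v i)));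
     rel_int := fun r v => rel_int M (fun i => proj1_sig (v i)) |}.

Definition elementary_substructure (L : language) (D : Type)
    (M : structure L D) (N : D -> Prop) : Prop :=
  exists H : closed_under M N,
    forall (phi : formula L) (s : nat -> {d : D | N d}),
      sat (substructure H) s phi <-> sat M (fun n => proj1_sig (s n)) phi.

Definition jonsson (k : V) : Prop :=
  forall L : language, countable_language L ->
  forall M : structure L (Elt k),
    exists N : V, N ⊆ k /\ N <> k /\ equinumerous N k /\
      elementary_substructure M (fun d => proj1_sig d ∈ N).

(** * Stationary sets *)

Definition finite_set (s : V) : Prop :=
  exists l : list V, forall y, y ∈ s <-> In y l.

(** [T] is stationary in $\wp(X)$; [f] is only used on $[X]^{<\omega}$, the
    finite subsets of [X] including the empty one. *)
Definition stationary_in (X T : V) : Prop :=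
  T ⊆ power X /\
  forall f : V -> V,
    (forall s, finite_set s -> s ⊆ X -> f s ∈ X) ->
    exists M, M ∈ T /\ forall s, finite_set s -> s ⊆ M -> f s ∈ M.

Definition stationary (S : V) : Prop := stationary_in (union S) S.

(** * Towers of normal ideals *)

Definition ideal_on (x I : V) : Prop :=
  I ⊆ power (power x) /\
  empty ∈ I /\
  power x ∉ I /\
  (forall A B, B ∈ I -> A ⊆ B -> A ∈ I) /\
  (forall A B, A ∈ I -> B ∈ I -> A ∪ B ∈ I).

Definition fine (x I : V) : Prop :=
  forall a, a ∈ x -> sep (power x) (fun M => a ∉ M) ∈ I.

Definition countably_complete (I : V) : Prop :=
  forall A : nat -> V, (forall n, A n ∈ I) -> bigcup A ∈ I.

(** Closure under diagonal unions. *)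
Definition normal (x I : V) : Prop :=
  forall A : V -> V, (forall a, a ∈ x -> A a ∈ I) ->
    sep (power x) (fun M => exists a, a ∈ M /\ M ∈ A a) ∈ I.

(** $\{M \subseteq y : M \cap x \in A\}$ *)
Definition lift (x y A : V) : V := sep (power y) (fun M => M ∩ x ∈ A).

(** Only the values of [I] on [stage l] matter. *)
Definition tower (l : V) (I : V -> V) : Prop :=
  ordinal l /\
  (forall x, x ∈ stage l ->
     ideal_on x (I x) /\ normal x (I x) /\ fine x (I x) /\
     countably_complete (I x)) /\
  (forall x y, x ∈ stage l -> y ∈ stage l -> x ⊆ y ->
     forall A, A ⊆ power x -> (A ∈ I x <-> lift x y A ∈ I y)).

Definition canonical_projection_NS (l : V) (I : V -> V) : Prop :=
  exists S : V, stationary S /\ stage l ⊆ union S /\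
    forall x A, x ∈ stage l -> A ⊆ power x ->
      (A ∈ I x <-> ~ stationary_in (union S) (sep S (fun M => M ∩ x ∈ A))).

(** * Forcing

    [phi p] reads "[p] forces [phi]".  The clauses are those of the usual
    definition of the forcing relation.  Quantifiers range over objects of the
    ground model; this is enough below because the points of the generic
    ultrapower are represented by ground model functions and the extension has
    no new ordinals. *)

Record poset : Type := Poset {
  condition :> Type;
  ple : condition -> condition -> Prop
}.

Definition fprop (P : poset) : Type := P -> Prop.

(** A statement about the ground model. *)
Definition fground (P : poset) (Q : Prop) : fprop P := fun _ => Q.

(** [c] belongs to the generic filter: [p] forces this iff the conditions below
    [c] are dense below [p]. *)
Definition fgen (P : poset) (c : P) : fprop P :=
  fun p => forall q, ple q p -> exists r, ple r q /\ ple r c.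

Definition fnot (P : poset) (phi : fprop P) : fprop P :=
  fun p => forall q, ple q p -> ~ phi q.

Definition fand (P : poset) (phi psi : fprop P) : fprop P :=
  fun p => phi p /\ psi p.

Definition fall (P : poset) (T : Type) (F : T -> fprop P) : fprop P :=
  fun p => forall t, F t p.

Definition fimp (P : poset) (phi psi : fprop P) : fprop P :=
  fnot (fand phi (fnot psi)).

Definition fex (P : poset) (T : Type) (F : T -> fprop P) : fprop P :=
  fnot (fall (fun t => fnot (F t))).

(** The maximal condition forces [phi]. *)
Definition forces (P : poset) (phi : fprop P) : Prop := forall p : P, phi p.

Unset Implicit Arguments.

(** * The forcing of a tower and its generic ultrapower *)

Definition tower_condition (l : V) (I : V -> V) (c : V * V) : Prop :=
  fst c ∈ stage l /\ snd c ⊆ power (fst c) /\ snd c ∉ I (fst c).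

(** Inclusion modulo the ideals, computed on the union of the supports. *)
Definition tower_le (I : V -> V) (c d : V * V) : Prop :=
  let z := fst c ∪ fst d in
  sep (power z) (fun M => M ∩ fst c ∈ snd c /\ M ∩ fst d ∉ snd d) ∈ I z.

Definition tower_poset (l : V) (I : V -> V) : poset :=
  {| condition := {c : V * V | tower_condition l I c};
     ple := fun p q => tower_le I (proj1_sig p) (proj1_sig q) |}.

(** $A \in G_z$, where $G_z = \{A : (z, A) \in G\}$ *)
Definition in_generic (l : V) (I : V -> V) (z A : V) : fprop (tower_poset l I) :=
  fex (fun c : {c : tower_poset l I | proj1_sig c = (z, A)} => fgen (proj1_sig c)).

(** Representatives of the points of the generic ultrapower: ground model
    functions with domain [power (usupp f)], where [usupp f] is in [stage l].
    The values of [uval f] outside [power (usupp f)] are never used. *)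
Record ufun : Type := UFun { usupp : V; uval : V -> V }.

(** The membership relation of the generic ultrapower. *)
Definition umem (l : V) (I : V -> V) (f g : ufun) : fprop (tower_poset l I) :=
  let z := usupp f ∪ usupp g in
  in_generic l I z
    (sep (power z) (fun M => uval f (M ∩ usupp f) ∈ uval g (M ∩ usupp g))).

(** The point $j(a)$, represented by a constant function. *)
Definition jconst (a : V) : ufun := UFun empty (fun _ => a).

(** [collapses_to l I a f]: the point represented by [f] is in the well-founded
    part of the generic ultrapower and its transitive collapse is the ground
    model set [a].  As usual the well-founded part is identified with its
    transitive collapse.  See [collapses_toE] for the recursion on [a]. *)
Definition collapses_to (l : V) (I : V -> V) : V -> ufun -> fprop (tower_poset l I) :=
  Fix mem_wf (fun _ => ufun -> fprop (tower_poset l I)) (fun a rec f =>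
    fand
      (fall (fun b : Elt a =>
         fex (fun g : ufun =>
           fand (fground (usupp g ∈ stage l))
             (fand (umem l I g f) (rec (proj1_sig b) (proj2_sig b) g)))))
      (fall (fun g : ufun =>
         fimp (fand (fground (usupp g ∈ stage l)) (umem l I g f))
           (fex (fun b : Elt a => rec (proj1_sig b) (proj2_sig b) g))))).

Lemma collapses_toE l I a f :
  collapses_to l I a f =
    fand
      (fall (fun b : Elt a =>
         fex (fun g : ufun =>
           fand (fground (usupp g ∈ stage l))
             (fand (umem l I g f) (collapses_to l I (proj1_sig b) g)))))
      (fall (fun g : ufun =>
         fimp (fand (fground (usupp g ∈ stage l)) (umem l I g f))
           (fex (fun b : Elt a => collapses_to l I (proj1_sig b) g)))).
Proof.
  unfold collapses_to at 1; rewrite Fix_eq; [reflexivity |].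
  intros x r r' H.
  assert (E : r = r').
  { apply functional_extensionality_dep; intro y.
    apply functional_extensionality_dep; intro h; apply H. }
  rewrite E; reflexivity.
Qed.

(** $j(a) = b$ *)
Definition j_eq (l : V) (I : V -> V) (a b : V) : fprop (tower_poset l I) :=
  collapses_to l I b (jconst a).

(** [k] is the least ordinal moved by $j$. *)
Definition is_crit (l : V) (I : V -> V) (k : V) : fprop (tower_poset l I) :=
  fand (fground (ordinal k))
    (fand (fall (fun a : Elt k => j_eq l I (proj1_sig a) (proj1_sig a)))
          (fnot (j_eq l I k k))).

(** [k] is the [n]th term of the critical sequence: $\kappa_0$ is the critical
    point of $j$ and $\kappa_{n+1} = j(\kappa_n)$. *)
Fixpoint crit_seq (l : V) (I : V -> V) (n : nat) (k : V) : fprop (tower_poset l I) :=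
  match n with
  | 0 => is_crit l I k
  | S m => fex (fun a : V => fand (crit_seq l I m a) (j_eq l I a k))
  end.

Definition I3_tower (l : V) (I : V -> V) : Prop :=
  tower l I /\ is_cf l omega /\
  forces
    (fand
       (fall (fun n : nat => fex (fun k : Elt l => crit_seq l I n (proj1_sig k))))
       (fall (fun b : Elt l => fex (fun n : nat => fex (fun k : Elt l =>
          fand (crit_seq l I n (proj1_sig k))
               (fground (proj1_sig b ⊆ proj1_sig k))))))).

Definition decides_crit_seq (l : V) (I : V -> V) : Prop :=
  exists k : nat -> V, forces (fall (fun n : nat => crit_seq l I n (k n))).

(* Main.v *)
Require Import Defs.
From Stdlib Require Import Classical ClassicalEpsilon FunctionalExtensionality
  PropExtensionality Arith List Lia Cantor.

(** Both directions rest on one fact about a tower projected from the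
    nonstationary ideal on [S]: in the generic ultrapower an ordinal [b] is
    represented by [M |-> otp (M ∩ b)], so [j(a) = b] is forced iff
    [otp (M ∩ b) = a] for almost all [M ∈ S].

    (2) => (1): if [k] is the decided critical sequence, almost every [M ∈ S]
    satisfies [otp (M ∩ k (n+1)) = k n] for all [n], does not contain [k 0], and
    is closed under Skolem functions for a given structure on [aleph_omega];
    [M ∩ aleph_omega] is then the required elementary substructure.

    (1) => (2): a proper subset [M] of full size in [aleph_omega], closed under
    enough functions, has [otp (M ∩ aleph h) = aleph j] for every
    large [j] and some [h > j], which yields a sequence [k] of
    natural numbers as above.  If for each of the [2^omega] many [k] the sets
    that yield [k] were nonstationary, then an [M] containing a code for each
    [k] and closed under all the witnessing functions would be contradictory.
    Such an [M] is the hull of a Jonsson subset [N] and [aleph m >= 2^omega]: by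
    regularity, adding [aleph m] does not raise [sup (N ∩ aleph (i+1))] for
    [i >= m], so the hull is still proper. *)

(** * Ordinals, ranks and pairing *)

(** The obstacle in (1) => (2) is a mismatch of domains. Stationarity concerns functions on all of
    [stage aleph_omega], a set much larger than [aleph_omega], while a Jonsson subset is closed only
    under countably many operations on [aleph_omega]. Moreover the sequence [k] is read off from [M]
    after [M] has been built, so [M] has to be prepared for continuum many functions, too many for a
    countable language; the index of the function therefore becomes an argument. Elements of the
    hull are named by a term, one parameter in [N] and one in [aleph m]. Only the term, taken from a
    countable set, enters the language: for each term and each level [i >= m] there is an operation
    on the first parameter alone that bounds the values below [aleph (S i)] as the second runs over
    [aleph m]. Closure of [N] under these bounds keeps the hull from containing a strict bound of
    [N ∩ aleph (S i)]. In (2) => (1) the countable completeness of the nonstationary ideal lets all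
    requirements on [M] hold at once, and normality accounts for the representation of ordinals by
    order types. *)

Lemma V_ind (P : V -> Prop) : (forall x, (forall y, y ∈ x -> P y) -> P x) -> forall x, P x.
Proof. exact (well_founded_ind mem_wf P). Qed.

Lemma mem_irrefl x : x ∉ x.
Proof. induction x as [x IH] using V_ind; intro h; exact (IH x h h). Qed.

Lemma subset_antisym x y : x ⊆ y -> y ⊆ x -> x = y.
Proof. intros H K; apply set_ext; intro z; split; auto. Qed.

Lemma ordinal_mem a b : ordinal a -> b ∈ a -> ordinal b.
Proof.
  intros [T H] hb; split; [exact (H b hb) |]; intros c hc.
  exact (H c (T b hb c hc)).
Qed.

Lemma ordinal_trans a b c : ordinal a -> b ∈ a -> c ∈ b -> c ∈ a.
Proof. intros [T _] hb hc; exact (T b hb c hc). Qed.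

Lemma ordinal_of_transitive a :
  transitive_set a -> (forall b, b ∈ a -> ordinal b) -> ordinal a.
Proof. intros T H; split; [exact T | intros b hb; destruct (H b hb); assumption]. Qed.

Lemma ordinal_total a b : ordinal a -> ordinal b -> a ∈ b \/ a = b \/ b ∈ a.
Proof.
  revert b; induction a as [a IHa] using V_ind; intro b.
  induction b as [b IHb] using V_ind; intros oa ob.
  destruct (classic (a ∈ b)) as [h|h]; [auto |].
  destruct (classic (b ∈ a)) as [k|k]; [auto |].
  right; left; apply set_ext; intro z; split; intro hz.
  - destruct (IHa z hz b (ordinal_mem _ _ oa hz) ob) as [H|[H|H]]; [exact H | |].
    + subst z; contradiction.
    + destruct k; exact (ordinal_trans a z b oa hz H).
  - destruct (IHb z hz oa (ordinal_mem _ _ ob hz)) as [H|[H|H]]; [| | exact H].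
    + destruct h; exact (ordinal_trans b z a ob hz H).
    + subst z; contradiction.
Qed.

Lemma ordinal_sub a b : ordinal a -> ordinal b -> b ∉ a -> a ⊆ b.
Proof.
  intros oa ob h z hz; destruct (ordinal_total a b oa ob) as [H|[H|H]].
  - exact (ordinal_trans b a z ob H hz).
  - subst b; exact hz.
  - contradiction.
Qed.

Lemma ordinal_sub_mem a b : ordinal a -> ordinal b -> a ⊆ b -> a = b \/ a ∈ b.
Proof.
  intros oa ob h; destruct (ordinal_total a b oa ob) as [H|[H|H]]; auto.
  destruct (mem_irrefl b (h b H)).
Qed.

Definition osucc (a : V) : V := a ∪ mkset (fun _ : unit => a).

Lemma mem_osucc a x : x ∈ osucc a <-> x ∈ a \/ x = a.
Proof.
  unfold osucc; rewrite mem_cup, mem_mkset; split; (intros [H|H]; [auto | right]).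
  - destruct H as [_ H]; exact H.
  - exists tt; exact H.
Qed.

Lemma ordinal_osucc a : ordinal a -> ordinal (osucc a).
Proof.
  intro oa; apply ordinal_of_transitive.
  - intros b hb c hc; apply mem_osucc; left; apply mem_osucc in hb.
    destruct hb as [hb | ->]; [exact (ordinal_trans _ _ _ oa hb hc) | exact hc].
  - intros b hb; apply mem_osucc in hb; destruct hb as [hb | ->];
      [exact (ordinal_mem _ _ oa hb) | exact oa].
Qed.

Lemma ofnat_S n : ofnat (S n) = osucc (ofnat n).
Proof. apply set_ext; intro z; rewrite mem_ofnat_S, mem_osucc; reflexivity. Qed.

Lemma ordinal_ofnat n : ordinal (ofnat n).
Proof.
  induction n as [|n IH].
  - split; intros y hy; apply mem_empty in hy; destruct hy.
  - rewrite ofnat_S; apply ordinal_osucc, IH.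
Qed.

Lemma ofnat_lt m n : m < n -> ofnat m ∈ ofnat n.
Proof. induction 1; rewrite mem_ofnat_S; auto. Qed.

Lemma ofnat_inj m n : ofnat m = ofnat n -> m = n.
Proof.
  intro E; destruct (Nat.lt_total m n) as [h|[h|h]]; auto;
    apply ofnat_lt in h; rewrite E in h; destruct (mem_irrefl _ h).
Qed.

Lemma mem_ofnat n x : x ∈ ofnat n <-> exists m, m < n /\ x = ofnat m.
Proof.
  split.
  - induction n as [|n IH]; intro h; [apply mem_empty in h; destruct h |].
    apply mem_ofnat_S in h; destruct h as [h|h]; [| exists n; auto].
    destruct (IH h) as (m & h1 & h2); exists m; auto.
  - intros (m & h & ->); apply ofnat_lt, h.
Qed.

Lemma mem_omega x : x ∈ omega <-> exists n, x = ofnat n.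
Proof. apply mem_mkset. Qed.

Lemma ordinal_omega : ordinal omega.
Proof.
  apply ordinal_of_transitive.
  - intros b hb c hc; apply mem_omega in hb; destruct hb as [n ->].
    apply mem_ofnat in hc; destruct hc as (m & _ & ->); apply mem_omega; eauto.
  - intros b hb; apply mem_omega in hb; destruct hb as [n ->]; apply ordinal_ofnat.
Qed.

Lemma ordinal_cup a b : ordinal a -> ordinal b -> a ∪ b = a \/ a ∪ b = b.
Proof.
  intros oa ob; destruct (classic (b ∈ a)) as [h|h]; [left | right];
    (apply subset_antisym; intros z hz; [apply mem_cup in hz; destruct hz as [hz|hz]; auto
                                        | apply mem_cup; auto]).
  - exact (ordinal_trans _ _ _ oa h hz).
  - exact (ordinal_sub a b oa ob h z hz).
Qed.

Lemma injects_sub x y : x ⊆ y -> injects x y.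
Proof. intro h; exists (fun v => v); auto. Qed.

Lemma injects_trans x y z : injects x y -> injects y z -> injects x z.
Proof.
  intros (f & f1 & f2) (g & g1 & g2); exists (fun v => g (f v)); split; auto.
Qed.

Lemma injects_image (f : V -> V) x y :
  (forall b, b ∈ y -> exists a, a ∈ x /\ b = f a) -> injects y x.
Proof.
  intro H; pose (g b := epsilon (inhabits empty) (fun a => a ∈ x /\ b = f a)).
  assert (K : forall b, b ∈ y -> g b ∈ x /\ b = f (g b)).
  { intros b hb; exact (epsilon_spec (inhabits empty) _ (H b hb)). }
  exists g; split; [intros b hb; apply (K b hb) |].
  intros a b ha hb E; rewrite (proj2 (K a ha)), (proj2 (K b hb)), E; reflexivity.
Qed.

Definition the_inj (x y : V) : V -> V :=
  epsilon (inhabits (fun v => v)) (fun f =>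
    (forall a, a ∈ x -> f a ∈ y) /\
    (forall a b, a ∈ x -> b ∈ x -> f a = f b -> a = b)).

Lemma the_inj_spec x y : injects x y ->
  (forall a, a ∈ x -> the_inj x y a ∈ y) /\
  (forall a b, a ∈ x -> b ∈ x -> the_inj x y a = the_inj x y b -> a = b).
Proof. intro H; exact (epsilon_spec (inhabits (fun v : V => v)) _ H). Qed.

(** * Ranks of set-like well-founded relations *)

Section Rank.
Variables (T : Type) (R : T -> T -> Prop) (wfR : well_founded R).
Hypothesis setlike : forall x, exists (A : Type) (f : A -> T), forall y, R y x -> exists i, y = f i.

Definition rank : T -> V :=
  Fix wfR (fun _ => V) (fun x rec => set_of (fun v => exists y (h : R y x), v = rec y h)).

Lemma mem_rank x v : v ∈ rank x <-> exists y, R y x /\ v = rank y.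
Proof.
  unfold rank at 1; rewrite Fix_eq.
  2:{ intros y f g H; f_equal; apply functional_extensionality; intro z.
      apply propositional_extensionality.
      split; intros (b & hb & K); exists b, hb; [rewrite <- H | rewrite H]; exact K. }
  fold rank; rewrite mem_set_of.
  - split; [intros (y & h & E) | intros (y & h & E)]; eauto.
  - destruct (setlike x) as (A & f & H).
    apply small_image with (f := fun a => rank (f a)).
    intros w (y & h & E); destruct (H y h) as [a ->]; exists a; exact E.
Qed.

Lemma ordinal_rank : (forall x y z, R x y -> R y z -> R x z) -> forall x, ordinal (rank x).
Proof.
  intros tr x; induction x as [x IH] using (well_founded_ind wfR).
  apply ordinal_of_transitive.
  - intros b hb c hc; apply mem_rank in hb; destruct hb as (y & hy & ->).
    apply mem_rank in hc; destruct hc as (z & hz & ->); apply mem_rank; eauto.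
  - intros b hb; apply mem_rank in hb; destruct hb as (y & hy & ->); auto.
Qed.

Lemma rank_inj x y : R x y \/ x = y \/ R y x -> rank x = rank y -> x = y.
Proof.
  intros [h|[h|h]] E; auto; exfalso.
  - apply (mem_irrefl (rank y)); rewrite <- E at 1; apply mem_rank; eauto.
  - apply (mem_irrefl (rank x)); rewrite E at 1; apply mem_rank; eauto.
Qed.

(** Every member of [rank x] is the rank of a predecessor of [x]; choosing one and applying [g] is
    injective. This is the tool for bounding the size of an order type. *)
Lemma injects_rank (g : T -> V) x k :
  (forall y, R y x -> g y ∈ k) ->
  (forall y z, R y x -> R z x -> g y = g z -> y = z) -> injects (rank x) k.
Proof.
  intros H K.
  assert (C : forall v, exists y, v ∈ rank x -> R y x /\ v = rank y).
  { intro v; destruct (classic (v ∈ rank x)) as [h|h].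
    - apply mem_rank in h; destruct h as (y & hy); exists y; auto.
    - exists x; contradiction. }
  pose (c v := proj1_sig (constructive_indefinite_description _ (C v))).
  assert (D : forall v, v ∈ rank x -> R (c v) x /\ v = rank (c v))
    by exact (fun v => proj2_sig (constructive_indefinite_description _ (C v))).
  exists (fun v => g (c v)); split.
  - intros v hv; apply H, D, hv.
  - intros v w hv hw E; destruct (D v hv) as [v1 v2], (D w hw) as [w1 w2].
    rewrite v2, w2; f_equal; apply K; auto.
Qed.
End Rank.

(** * Gödel pairing *)

Definition pairing (k : V) : Prop := exists P : V -> V -> V,
  (forall a b, a ∈ k -> b ∈ k -> P a b ∈ k) /\
  (forall a b c d, a ∈ k -> b ∈ k -> c ∈ k -> d ∈ k -> P a b = P c d -> a = c /\ b = d).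

(** Gödel's well-order by maximum, then lexicographically; for ordinals the maximum is the union.
    Requiring the smaller pair to lie in [k] makes the relation set-like on all of [V * V]. *)
Definition max_lex (k : V) (p q : V * V) : Prop :=
  fst p ∈ k /\ snd p ∈ k /\
  (fst p ∪ snd p ∈ fst q ∪ snd q \/
   fst p ∪ snd p = fst q ∪ snd q /\
   (fst p ∈ fst q \/ fst p = fst q /\ snd p ∈ snd q)).

Lemma max_lex_wf k : well_founded (max_lex k).
Proof.
  assert (H : forall u a b : V, forall q, fst q ∪ snd q = u -> fst q = a -> snd q = b ->
    Acc (max_lex k) q).
  { induction u as [u IHu] using V_ind; induction a as [a IHa] using V_ind.
    induction b as [b IHb] using V_ind; intros q E1 E2 E3; constructor.
    intros p (_ & _ & [h|(h & [h'|(h' & h'')])]).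
    - rewrite E1 in h; exact (IHu _ h _ _ p eq_refl eq_refl eq_refl).
    - rewrite E1 in h; rewrite E2 in h'; exact (IHa _ h' _ p h eq_refl eq_refl).
    - rewrite E1 in h; rewrite E2 in h'; rewrite E3 in h''.
      exact (IHb _ h'' p h h' eq_refl). }
  intro q; exact (H _ _ _ q eq_refl eq_refl eq_refl).
Qed.

(** Gödel's pairing: the rank of a pair in [max_lex] injects into some [c × c]. *)
Lemma pairing_ordinal k : ordinal k ->
  (forall a, a ∈ k -> exists c, injects (osucc a) c /\ pairing c /\
     forall r, ordinal r -> injects r c -> r ∈ k) ->
  pairing k.
Proof.
  intros ok H.
  assert (cup_in : forall a b, a ∈ k -> b ∈ k -> a ∪ b ∈ k).
  { intros a b ha hb; destruct (ordinal_cup a b) as [->| ->]; auto;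
      eapply ordinal_mem; eauto. }
  assert (ordk := fun a => ordinal_mem k a ok).
  (* All predecessors of [q] lie in the square of [osucc] of its maximum, a set of pairs that the
     pairing on [c] can absorb. *)
  assert (below : forall p q, fst q ∈ k -> snd q ∈ k -> max_lex k p q ->
    fst p ∪ snd p ∈ osucc (fst q ∪ snd q) /\
    fst p ∈ osucc (fst q ∪ snd q) /\ snd p ∈ osucc (fst q ∪ snd q)).
  { intros [a b] [c d] hc hd (ha & hb & h); cbn [fst snd] in *.
    assert (h' : a ∪ b ∈ osucc (c ∪ d)) by (apply mem_osucc; tauto).
    assert (oo : ordinal (osucc (c ∪ d))) by auto using ordinal_osucc.
    assert (K : forall x, x ∈ k -> x ⊆ a ∪ b -> x ∈ osucc (c ∪ d)).
    { intros x hx hs; destruct (ordinal_sub_mem x (a ∪ b)) as [->|E]; auto.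
      eapply ordinal_trans; eauto. }
    repeat split; auto; apply K; auto; intros z hz; apply mem_cup; auto. }
  assert (setlike : forall x, exists (A : Type) (f : A -> V * V), forall y, max_lex k y x ->
     exists i, y = f i).
  { intro x; destruct (mkset_surj k) as (A & e & E).
    exists (A * A)%type, (fun ij => (e (fst ij), e (snd ij))).
    intros [a b] (ha & hb & _); cbn [fst snd] in *; rewrite E in ha, hb.
    apply mem_mkset in ha; apply mem_mkset in hb; destruct ha as [i ->], hb as [j ->].
    exists (i, j); reflexivity. }
  exists (fun a b => rank _ _ (max_lex_wf k) (a, b)); split.
  - intros a b ha hb; destruct (H (a ∪ b) (cup_in a b ha hb)) as (c & ic & (P & P1 & P2) & K).
    apply K.
    (* Transitivity is proved when the top pair lies in [k], so that its coordinates are ordinals.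
       Since [ordinal_rank] asks for transitivity everywhere, [L] repeats its argument for such
       pairs. *)
    + assert (tr : forall x y z, fst z ∈ k -> snd z ∈ k -> max_lex k x y -> max_lex k y z -> max_lex k x z).
      { intros [x1 x2] [y1 y2] [z1 z2] hz1 hz2 (h1 & h2 & h3) (h4 & h5 & h6).
        unfold max_lex; cbn [fst snd] in *; split; [exact h1 | split; [exact h2 |]].
        assert (o1 := ordk _ hz1); assert (o2 := ordk _ hz2).
        assert (o3 := ordk _ (cup_in _ _ hz1 hz2)).
        destruct h3 as [h3|(h3 & h3')], h6 as [h6|(h6 & h6')].
        - left; eapply ordinal_trans; eauto.
        - left; rewrite <- h6; auto.
        - left; rewrite h3; auto.
        - right; split; [congruence |].
          destruct h3' as [a1|[a1 a2]], h6' as [b1|[b1 b2]].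
          + left; eapply ordinal_trans; eauto.
          + left; subst; auto.
          + left; subst; auto.
          + right; subst; split; auto; eapply ordinal_trans; eauto. }
      assert (L : forall x, fst x ∈ k -> snd x ∈ k -> ordinal (rank _ _ (max_lex_wf k) x)).
      { intros x; induction x as [x IH] using (well_founded_ind (max_lex_wf k)); intros hx1 hx2.
        apply ordinal_of_transitive.
        - intros u hu v hv; apply (mem_rank _ _ _ setlike) in hu; destruct hu as (y & hy & ->).
          apply (mem_rank _ _ _ setlike) in hv; destruct hv as (z & hz & ->).
          apply (mem_rank _ _ _ setlike); exists z; split; eauto.
        - intros u hu; apply (mem_rank _ _ _ setlike) in hu; destruct hu as (y & hy & ->).
          apply IH; auto; apply hy. }
      apply L; auto.
    + destruct ic as (f & f1 & f2).
      apply (injects_rank _ _ _ setlike (fun p => P (f (fst p)) (f (snd p)))).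
      * intros p hp; apply (below p (a,b)) in hp; cbn [fst snd] in *; auto.
        apply P1; apply f1; tauto.
      * intros p q hp hq E; apply (below p (a,b)) in hp; cbn [fst snd] in *; auto.
        apply (below q (a,b)) in hq; cbn [fst snd] in *; auto.
        apply P2 in E; try (apply f1; tauto); destruct E as [E1 E2].
        apply f2 in E1; try tauto; apply f2 in E2; try tauto.
        destruct p, q; cbn [fst snd] in *; congruence.
  - intros a b c d ha hb hc hd E.
    apply (rank_inj _ _ _ setlike) in E; [split; congruence |].
    unfold max_lex; cbn [fst snd].
    destruct (ordinal_total (a ∪ b) (c ∪ d)) as [h|[h|h]]; auto 6.
    destruct (ordinal_total a c) as [h'|[h'|h']]; auto 8.
    destruct (ordinal_total b d) as [h''|[h''|h'']]; auto 10.
    right; left; congruence.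
Qed.

(** * Alephs and order types *)

Lemma ordinal_card_succ k : ordinal (card_succ k).
Proof.
  apply ordinal_of_transitive; [| intros b hb; apply mem_card_succ in hb; tauto].
  intros a ha b hb; apply mem_card_succ in ha; destruct ha as [oa ia].
  apply mem_card_succ; split; [exact (ordinal_mem _ _ oa hb) |].
  eapply injects_trans; [| exact ia]; exact (injects_sub _ _ (proj1 oa b hb)).
Qed.

Lemma ordinal_aleph n : ordinal (aleph n).
Proof. destruct n; [exact ordinal_omega | apply ordinal_card_succ]. Qed.

Lemma mem_aleph_S n a : a ∈ aleph (S n) <-> ordinal a /\ injects a (aleph n).
Proof. apply mem_card_succ. Qed.

Lemma aleph_sub_S n : aleph n ⊆ aleph (S n).
Proof.
  intros x hx; apply mem_aleph_S; split; [exact (ordinal_mem _ _ (ordinal_aleph n) hx) |].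
  exact (injects_sub _ _ (proj1 (ordinal_aleph n) x hx)).
Qed.

Lemma aleph_mem_S n : aleph n ∈ aleph (S n).
Proof. apply mem_aleph_S; split; [apply ordinal_aleph | apply injects_sub; intros z h; exact h]. Qed.

Lemma aleph_le m n : m <= n -> aleph m ⊆ aleph n.
Proof.
  induction 1; intros z hz; [exact hz | apply aleph_sub_S; auto].
Qed.

Lemma aleph_lt m n : m < n -> aleph m ∈ aleph n.
Proof. intro h; exact (aleph_le _ _ h _ (aleph_mem_S m)). Qed.

Lemma aleph_not_injects n : ~ injects (aleph (S n)) (aleph n).
Proof.
  intro h; apply (mem_irrefl (aleph (S n))), mem_aleph_S; split; [apply ordinal_aleph | exact h].
Qed.

Lemma mem_aleph_omega x : x ∈ aleph_omega <-> exists n, x ∈ aleph n.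
Proof. apply mem_bigcup. Qed.

Lemma aleph_mem_omega n : aleph n ∈ aleph_omega.
Proof. apply mem_aleph_omega; exists (S n); apply aleph_mem_S. Qed.

Lemma aleph_sub_omega n : aleph n ⊆ aleph_omega.
Proof. intros x hx; apply mem_aleph_omega; eauto. Qed.

Lemma ordinal_aleph_omega : ordinal aleph_omega.
Proof.
  apply ordinal_of_transitive; intros b hb; apply mem_aleph_omega in hb; destruct hb as [n hn].
  - intros c hc; apply mem_aleph_omega; exists n; exact (ordinal_trans _ _ _ (ordinal_aleph n) hn hc).
  - exact (ordinal_mem _ _ (ordinal_aleph n) hn).
Qed.

Lemma ofnat_mem_aleph i n : ofnat i ∈ aleph n.
Proof. apply (aleph_le 0 n); [lia |]; apply mem_omega; eauto. Qed.

(** The pairing makes room for one more point: [a] goes to pairs with first coordinate 0, the new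
    point to a pair with first coordinate 1. *)
Lemma injects_osucc a n : injects a (aleph n) -> pairing (aleph n) -> injects (osucc a) (aleph n).
Proof.
  intros (f & f1 & f2) (P & P1 & P2); assert (Z := fun i => ofnat_mem_aleph i n).
  exists (fun x => if excluded_middle_informative (x ∈ a)
                   then P (ofnat 0) (f x) else P (ofnat 1) (ofnat 0)); split.
  - intros x _; destruct (excluded_middle_informative _); auto.
  - intros x y hx hy; apply mem_osucc in hx; apply mem_osucc in hy.
    destruct (excluded_middle_informative (x ∈ a)) as [h|h],
      (excluded_middle_informative (y ∈ a)) as [h'|h']; intro E.
    + apply P2 in E; auto; apply f2; tauto.
    + apply P2 in E; auto; destruct E as [E _]; apply ofnat_inj in E; discriminate.
    + apply P2 in E; auto; destruct E as [E _]; apply ofnat_inj in E; discriminate.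
    + destruct hx, hy; try contradiction; congruence.
Qed.

(** At a successor the set [c] of [pairing_ordinal] is [aleph n], because [aleph (S n)] consists
    exactly of the ordinals that inject into it. *)
Lemma pairing_aleph n : pairing (aleph n).
Proof.
  induction n as [|n IH].
  - assert (C : forall x, exists i, x ∈ omega -> x = ofnat i).
    { intro x; destruct (classic (x ∈ omega)) as [h|h]; [| exists 0; contradiction].
      apply mem_omega in h; destruct h as [i hi]; exists i; auto. }
    pose (c x := proj1_sig (constructive_indefinite_description _ (C x))).
    assert (D : forall x, x ∈ omega -> x = ofnat (c x))
      by exact (fun x => proj2_sig (constructive_indefinite_description _ (C x))).
    exists (fun a b => ofnat (to_nat (c a, c b))); split.
    + intros a b _ _; apply mem_omega; eauto.
    + intros a b a' b' ha hb ha' hb' E; apply ofnat_inj, to_nat_inj in E.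
      apply D in ha; apply D in hb; apply D in ha'; apply D in hb'.
      split; congruence.
  - apply pairing_ordinal; [apply ordinal_aleph |]; intros a ha.
    exists (aleph n); split; [| split; [exact IH |]].
    + apply injects_osucc; auto; apply mem_aleph_S in ha; tauto.
    + intros r h1 h2; apply mem_aleph_S; auto.
Qed.

Lemma osucc_mem_aleph_S n a : a ∈ aleph (S n) -> osucc a ∈ aleph (S n).
Proof.
  intro ha; apply mem_aleph_S in ha; destruct ha as [oa ia]; apply mem_aleph_S; split;
    [apply ordinal_osucc, oa | apply injects_osucc; auto using pairing_aleph].
Qed.

Lemma osucc_mem_aleph_omega a : a ∈ aleph_omega -> osucc a ∈ aleph_omega.
Proof.
  intro ha; apply mem_aleph_omega in ha; destruct ha as [n hn].
  apply mem_aleph_omega; exists (S n); apply osucc_mem_aleph_S, aleph_sub_S, hn.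
Qed.

Lemma pairing_aleph_omega : pairing aleph_omega.
Proof.
  apply pairing_ordinal; [apply ordinal_aleph_omega |]; intros a ha.
  apply mem_aleph_omega in ha; destruct ha as [n ha]; apply aleph_sub_S in ha.
  exists (aleph n); split; [| split; [apply pairing_aleph |]].
  - apply injects_osucc; auto using pairing_aleph; apply mem_aleph_S in ha; tauto.
  - intros r h1 h2; apply (aleph_sub_omega (S n)), mem_aleph_S; auto.
Qed.

(** Regularity of [aleph (S n)]: the union of [y] is covered by at most [aleph n] sets that inject
    into [aleph n], so pairing an index with a position injects the union into [aleph n]. *)
Lemma aleph_S_bounded n y : y ⊆ aleph (S n) -> injects y (aleph n) ->
  exists d, d ∈ aleph (S n) /\ forall x, x ∈ y -> x ∈ d.
Proof.
  intros hy (f & f1 & f2); destruct (pairing_aleph n) as (P & P1 & P2).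
  assert (ou : ordinal (union y)).
  { apply ordinal_of_transitive; intros b hb; apply mem_union in hb; destruct hb as (z & hz & hb);
      assert (oz := ordinal_mem _ _ (ordinal_aleph _) (hy z hz)).
    - intros c hc; apply mem_union; exists z; split; auto; exact (ordinal_trans _ _ _ oz hb hc).
    - exact (ordinal_mem _ _ oz hb). }
  assert (K : union y ∈ aleph (S n)).
  { apply mem_aleph_S; split; [exact ou |].
    pose (c x := epsilon (inhabits empty) (fun z => z ∈ y /\ x ∈ z)).
    assert (C : forall x, x ∈ union y -> c x ∈ y /\ x ∈ c x).
    { intros x hx; apply mem_union in hx; exact (epsilon_spec (inhabits empty) _ hx). }
    assert (I : forall z, z ∈ y -> injects z (aleph n))
      by (intros z hz; apply hy, mem_aleph_S in hz; tauto).
    exists (fun x => P (f (c x)) (the_inj (c x) (aleph n) x)); split.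
    - intros x hx; destruct (C x hx) as [c1 c2]; apply P1; auto.
      apply the_inj_spec; auto.
    - intros a b ha hb E; destruct (C a ha) as [a1 a2], (C b hb) as [b1 b2].
      apply P2 in E; auto; try (apply the_inj_spec; auto).
      destruct E as [E1 E2]; apply f2 in E1; auto; rewrite <- E1 in E2.
      rewrite <- E1 in b2; apply the_inj_spec in E2; auto. }
  (* The successor makes the bound strict, since [union y] may belong to [y]. *)
  exists (osucc (union y)); split; [apply osucc_mem_aleph_S, K |].
  intros x hx; apply mem_osucc.
  destruct (ordinal_sub_mem x (union y)); auto.
  - exact (ordinal_mem _ _ (ordinal_aleph _) (hy x hx)).
  - intros z hz; apply mem_union; eauto.
Qed.

(** Demanding that the larger side be an ordinal makes the relation transitive on all of [V], so
    every rank is an ordinal; a set that is not an ordinal gets the empty rank. *)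
Definition below_in (M b a : V) : Prop := ordinal a /\ b ∈ a /\ b ∈ M.

Lemma below_in_wf M : well_founded (below_in M).
Proof.
  intro a; induction a as [a IH] using V_ind; constructor; intros b (_ & hb & _); auto.
Qed.

Lemma below_in_setlike M a : exists (A : Type) (f : A -> V), forall b, below_in M b a -> exists i, b = f i.
Proof.
  destruct (mkset_surj a) as (A & e & E); exists A, e; intros b (_ & hb & _).
  rewrite E in hb; apply mem_mkset in hb; exact hb.
Qed.

(** For ordinals [a], [mos M a] is the order type of [M ∩ a], and
    [b |-> mos M b] is the Mostowski collapse of [M ∩ a]. *)
Definition mos (M : V) : V -> V := rank _ _ (below_in_wf M).

Lemma mem_mos M a y : ordinal a ->
  (y ∈ mos M a <-> exists b, b ∈ a /\ b ∈ M /\ y = mos M b).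
Proof.
  intro oa; unfold mos at 1; rewrite (mem_rank _ _ _ (below_in_setlike M)); unfold below_in.
  split; [intros (b & (_ & h) & E) | intros (b & h1 & h2 & E)]; exists b; tauto.
Qed.

Lemma ordinal_mos M a : ordinal (mos M a).
Proof.
  apply ordinal_rank; [apply below_in_setlike |].
  intros x y z (h1 & h2 & h3) (h4 & h5 & h6); exact (conj h4 (conj (ordinal_trans _ _ _ h4 h5 h2) h3)).
Qed.

Lemma mos_inj M a b : ordinal a -> ordinal b -> a ∈ M -> b ∈ M -> mos M a = mos M b -> a = b.
Proof.
  intros oa ob ha hb; apply rank_inj; [apply below_in_setlike |]; unfold below_in.
  destruct (ordinal_total a b oa ob) as [h|[h|h]]; auto 10.
Qed.

Lemma mos_mono M a b : ordinal a -> ordinal b -> a ⊆ b -> mos M a ⊆ mos M b.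
Proof.
  intros oa ob h y hy; apply mem_mos in hy; auto; destruct hy as (c & h1 & h2 & ->).
  apply mem_mos; eauto.
Qed.

Lemma mos_sub M a : ordinal a -> mos M a ⊆ a.
Proof.
  induction a as [a IH] using V_ind; intros oa y hy; apply mem_mos in hy; auto.
  destruct hy as (b & hb & _ & ->).
  assert (ob := ordinal_mem _ _ oa hb).
  destruct (ordinal_sub_mem (mos M b) b) as [E|E]; auto using ordinal_mos.
  - rewrite E; exact hb.
  - exact (ordinal_trans _ _ _ oa hb E).
Qed.

Lemma mos_full M a : ordinal a -> a ⊆ M -> mos M a = a.
Proof.
  induction a as [a IH] using V_ind; intros oa h.
  assert (K : forall b, b ∈ a -> mos M b = b).
  { intros b hb; apply IH; auto; [exact (ordinal_mem _ _ oa hb) |].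
    intros c hc; apply h; exact (ordinal_trans _ _ _ oa hb hc). }
  apply set_ext; intro y; rewrite mem_mos; auto; split.
  - intros (b & hb & _ & ->); rewrite K; auto.
  - intro hy; exists y; rewrite K; auto.
Qed.

(** The collapse of [a] sees only [M ∩ a]. Hence order types are functions on [power a], with a
    support that a tower of height [aleph_omega] can handle. *)
Lemma mos_cap M x a : ordinal a -> a ⊆ x -> mos (M ∩ x) a = mos M a.
Proof.
  induction a as [a IH] using V_ind; intros oa h.
  assert (K : forall b, b ∈ a -> mos (M ∩ x) b = mos M b).
  { intros b hb; apply IH; auto; [exact (ordinal_mem _ _ oa hb) |].
    intros c hc; apply h; exact (ordinal_trans _ _ _ oa hb hc). }
  apply set_ext; intro y; rewrite !mem_mos; auto; split.
  - intros (b & h1 & h2 & ->); apply mem_cap in h2; exists b; rewrite K; tauto.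
  - intros (b & h1 & h2 & ->); exists b; rewrite mem_cap, K; auto.
Qed.

Lemma injects_mos M a k : ordinal a -> injects (M ∩ a) k -> injects (mos M a) k.
Proof.
  intros oa (f & f1 & f2); apply injects_rank with (g := f); [apply below_in_setlike | |].
  - intros b (_ & h1 & h2); apply f1, mem_cap; auto.
  - intros b c (_ & h1 & h2) (_ & h3 & h4) E; apply f2; auto; apply mem_cap; auto.
Qed.

Lemma injects_to_mos M a : ordinal a -> injects (M ∩ a) (mos M a).
Proof.
  intros oa; exists (mos M); split.
  - intros b hb; apply mem_cap in hb; apply mem_mos; auto; exists b; tauto.
  - intros b c hb hc; apply mem_cap in hb; apply mem_cap in hc.
    apply mos_inj; try tauto; eapply ordinal_mem; eauto; tauto.
Qed.

Lemma mos_mem M a b : ordinal a -> b ∈ a -> b ∈ M -> mos M b ∈ mos M a.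
Proof. intros oa h1 h2; apply mem_mos; eauto. Qed.

(** * The nonstationary ideal *)

Lemma countable_inj (A B : Type) (f : A -> B) :
  (forall x y, f x = f y -> x = y) -> countable_type B -> countable_type A.
Proof. intros H [c hc]; exists (fun x => c (f x)); auto. Qed.

Lemma countable_nat : countable_type nat.
Proof. exists (fun n => n); auto. Qed.

Lemma countable_prod A B : countable_type A -> countable_type B -> countable_type (A * B).
Proof.
  intros [c hc] [d hd]; exists (fun p => to_nat (c (fst p), d (snd p))).
  intros [a b] [a' b'] E; apply to_nat_inj in E; injection E as E1 E2; cbn in *.
  f_equal; auto.
Qed.

Lemma countable_sum A B : countable_type A -> countable_type B -> countable_type (A + B).
Proof.
  intros [c hc] [d hd].
  exists (fun s => match s with inl a => to_nat (0, c a) | inr b => to_nat (1, d b) end).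
  intros [a|b] [a'|b'] E; apply to_nat_inj in E; try discriminate; injection E as E;
    f_equal; auto.
Qed.

Fixpoint list_code (l : list nat) : nat :=
  match l with nil => 0 | x :: l => S (to_nat (x, list_code l)) end.

Lemma list_code_inj l l' : list_code l = list_code l' -> l = l'.
Proof.
  revert l'; induction l as [|x l IH]; intros [|y l'] E; try discriminate; auto.
  cbn [list_code] in E; apply Nat.succ_inj, to_nat_inj in E.
  injection E as E1 E2; f_equal; auto.
Qed.

Lemma countable_list A : countable_type A -> countable_type (list A).
Proof.
  intros [c hc].
  exists (fun l => list_code (map c l)); intros l l' E; apply list_code_inj in E.
  revert l' E; induction l as [|x l IH]; intros [|y l'] E; try discriminate; auto.
  injection E as E1 E2; f_equal; auto.
Qed.

Lemma countable_enum A : countable_type A -> exists e : nat -> option A, forall a, exists n, e n = Some a.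
Proof.
  intros [c hc].
  exists (fun n => match excluded_middle_informative (exists a, c a = n) with
                   | left h => Some (proj1_sig (constructive_indefinite_description _ h))
                   | right _ => None end).
  intro a; exists (c a); destruct (excluded_middle_informative _) as [h|h].
  - destruct (constructive_indefinite_description _ h) as [b hb]; cbn; f_equal; auto.
  - destruct h; eauto.
Qed.

(** * Merging countably many closure conditions into one *)

Definition adjoin (s x : V) : V := s ∪ mkset (fun _ : unit => x).

Lemma mem_adjoin s x y : y ∈ adjoin s x <-> y ∈ s \/ y = x.
Proof.
  unfold adjoin; rewrite mem_cup, mem_mkset; split; (intros [H|H]; [auto | right]).
  - destruct H as [_ H]; exact H.
  - exists tt; exact H.
Qed.

Lemma finite_empty : finite_set empty.
Proof. exists nil; intro y; rewrite mem_empty; reflexivity. Qed.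

Lemma finite_adjoin s x : finite_set s -> finite_set (adjoin s x).
Proof.
  intros [l hl]; exists (x :: l); intro y; rewrite mem_adjoin, hl; cbn; intuition congruence.
Qed.

Lemma set_of_list (l : list V) : exists s, finite_set s /\ forall y, y ∈ s <-> In y l.
Proof.
  induction l as [|x l (s & fs & hs)].
  - exists empty; split; [exact finite_empty |]; intro y; rewrite mem_empty; reflexivity.
  - exists (adjoin s x); split; [exact (finite_adjoin s x fs) |].
    intro y; rewrite mem_adjoin, hs; cbn; intuition congruence.
Qed.

Lemma finite_sub s t : finite_set t -> s ⊆ t -> finite_set s.
Proof.
  intros [l hl] h.
  exists (filter (fun y => if excluded_middle_informative (y ∈ s) then true else false) l).
  intro y; rewrite filter_In, <- hl; destruct (excluded_middle_informative _); intuition; discriminate.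
Qed.

Definition closed_fin (f : V -> V) (M : V) : Prop :=
  forall s, finite_set s -> s ⊆ M -> f s ∈ M.

Definition closed_list (g : list V -> V) (M : V) : Prop :=
  forall l, (forall x, In x l -> x ∈ M) -> g l ∈ M.

Definition is_max (t : V) (m : nat) : Prop :=
  ofnat m ∈ t /\ forall k, ofnat k ∈ t -> k <= m.

(** [omega ⊆ X] provides enough tags to code countably many functions on finite
    sets by one: [t] stands for the application of the function with index
    [fst (of_nat m)] to [t] without [m], where [m] is the largest natural
    number in [t].  Singletons of numbers serve to generate [omega]. *)
Definition merge (F : nat -> V -> V) (t : V) : V :=
  match excluded_middle_informative (exists m, is_max t m) with
  | right _ => ofnat 0
  | left h =>
      let m := proj1_sig (constructive_indefinite_description _ h) in
      if excluded_middle_informative (exists y, y ∈ t /\ y <> ofnat m)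
      then F (fst (of_nat m)) (sep t (fun y => y <> ofnat m))
      else ofnat (S m)
  end.

Lemma merge_closed (F : nat -> V -> V) X : omega ⊆ X ->
  (forall n, closed_fin (F n) X) -> closed_fin (merge F) X.
Proof.
  intros hw H s fs hs; assert (K : forall n, ofnat n ∈ X) by (intro; apply hw, mem_omega; eauto).
  unfold merge; destruct (excluded_middle_informative _); auto.
  destruct (excluded_middle_informative _); auto.
  apply H; [apply (finite_sub _ s fs) |]; intros y hy; apply mem_sep in hy; [tauto | apply hs; tauto].
Qed.

Lemma is_max_unique t m m' : is_max t m -> is_max t m' -> m = m'.
Proof. intros [h1 h2] [h3 h4]; apply Nat.le_antisymm; auto. Qed.

Lemma merge_max F t m : is_max t m -> (exists y, y ∈ t /\ y <> ofnat m) ->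
  merge F t = F (fst (of_nat m)) (sep t (fun y => y <> ofnat m)).
Proof.
  intros hm hy; unfold merge.
  destruct (excluded_middle_informative _) as [h|h]; [| destruct h; eauto].
  destruct (constructive_indefinite_description _ h) as [m' hm']; cbn.
  rewrite <- (is_max_unique _ _ _ hm hm').
  destruct (excluded_middle_informative _); [reflexivity | contradiction].
Qed.

Lemma merge_omega F M : closed_fin (merge F) M -> omega ⊆ M.
Proof.
  intros H x hx; apply mem_omega in hx; destruct hx as [n ->]; induction n as [|n IH].
  - assert (K : merge F empty ∈ M).
    { apply H; [exact finite_empty |]; intros y hy; apply mem_empty in hy; destruct hy. }
    unfold merge in K; destruct (excluded_middle_informative _) as [h|h]; [| exact K].
    exfalso; clear K; destruct h as [m [h _]]; apply mem_empty in h; exact h.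
  - assert (E : forall y, y ∈ adjoin empty (ofnat n) <-> y = ofnat n).
    { intro y; rewrite mem_adjoin, mem_empty; tauto. }
    assert (K : merge F (adjoin empty (ofnat n)) ∈ M).
    { apply H; [exact (finite_adjoin _ _ finite_empty) |]; intros y hy; apply E in hy; subst; exact IH. }
    assert (hm : is_max (adjoin empty (ofnat n)) n).
    { split; [apply E; reflexivity |]; intros k hk; apply E, ofnat_inj in hk; lia. }
    unfold merge in K; destruct (excluded_middle_informative _) as [h|h]; [| destruct h; eauto].
    destruct (constructive_indefinite_description _ h) as [m' hm']; cbn [proj1_sig] in K.
    rewrite <- (is_max_unique _ _ _ hm hm') in K.
    destruct (excluded_middle_informative _) as [(y & h1 & h2)|_]; [| exact K].
    apply E in h1; contradiction.
Qed.

(** The tag [to_nat (n, p)] codes [n] and, for [p] above all natural numbers in [s], exceeds them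
    all, so [merge] recognizes and removes it. A nonempty [s] keeps the tagged set from being read
    as the singleton of a number. *)
Lemma merge_nonempty F M : closed_fin (merge F) M ->
  forall n s, finite_set s -> s ⊆ M -> (exists y, y ∈ s) -> F n s ∈ M.
Proof.
  intros H n s fs hs [y hy].
  assert (B : exists p, forall k, ofnat k ∈ s -> k < p).
  { destruct fs as [l hl].
    assert (B : exists p, forall k, In (ofnat k) l -> k < p).
    { clear hl; induction l as [|x l [p hp]]; [exists 0; intros k [] |].
      destruct (classic (exists j, x = ofnat j)) as [[j ->]|no].
      - exists (S (j + p)); intros k [E|h]; [apply ofnat_inj in E; lia |].
        apply hp in h; lia.
      - exists p; intros k [E|h]; [destruct no; eauto | auto]. }
    destruct B as [p hp]; exists p; intros k hk; apply hp, hl, hk. }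
  destruct B as [p hp]; pose (m := to_nat (n, p)).
  assert (hm : p <= m) by (unfold m; pose proof (to_nat_non_decreasing n p); lia).
  assert (ns : ofnat m ∉ s) by (intro h; apply hp in h; lia).
  assert (mx : is_max (adjoin s (ofnat m)) m).
  { split; [apply mem_adjoin; auto |]; intros k hk; apply mem_adjoin in hk.
    destruct hk as [hk|hk]; [apply hp in hk; lia | apply ofnat_inj in hk; lia]. }
  assert (K : merge F (adjoin s (ofnat m)) ∈ M).
  { apply H; [apply finite_adjoin, fs |]; intros z hz; apply mem_adjoin in hz.
    destruct hz as [hz| ->]; [apply hs, hz | apply (merge_omega F M H), mem_omega; eauto]. }
  rewrite (merge_max F _ m mx) in K.
  2:{ exists y; split; [apply mem_adjoin; auto | intro E; subst; contradiction]. }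
  unfold m in K at 1; rewrite cancel_of_to in K; cbn [fst] in K.
  replace (sep _ _) with s in K; [exact K |].
  apply set_ext; intro z; rewrite mem_sep, mem_adjoin; split.
  - intro hz; split; auto; intros ->; contradiction.
  - intros [[hz|hz] h]; [exact hz | contradiction].
Qed.

(** Since [merge] serves only nonempty arguments, each function is entered twice: with the flag
    [false] it returns its value at [empty], whatever nonempty set it is given. *)
Lemma combine_fin (I : Type) (cI : countable_type I) (F : I -> V -> V) X : omega ⊆ X ->
  (forall i, closed_fin (F i) X) ->
  exists f, closed_fin f X /\ forall M, closed_fin f M -> forall i, closed_fin (F i) M.
Proof.
  intros hw H; destruct (countable_enum (I * bool)) as [e he].
  { apply countable_prod; auto; exists (fun b : bool => if b then 0 else 1).
    intros [|] [|]; auto; discriminate. }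
  pose (G n s := match e n with
    | Some (i, true) => F i s | Some (i, false) => F i empty | None => ofnat 0 end).
  exists (merge G); split.
  - apply merge_closed; auto; intros n s fs hs; unfold G; destruct (e n) as [[i [|]]|].
    + apply H; auto.
    + apply H; [exact finite_empty |]; intros y hy; apply mem_empty in hy; destruct hy.
    + apply hw, mem_omega; eauto.
  - intros M hM i s fs hs; destruct (classic (exists y, y ∈ s)) as [hy|no].
    + destruct (he (i, true)) as [n hn]; pose proof (merge_nonempty G M hM n s fs hs hy) as K.
      unfold G in K; rewrite hn in K; exact K.
    + assert (E : s = empty).
      { apply set_ext; intro z; rewrite mem_empty; split; [intro hz; destruct no; eauto | tauto]. }
      destruct (he (i, false)) as [n hn].
      pose proof (merge_nonempty G M hM n (adjoin empty (ofnat 0))) as K.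
      unfold G in K; rewrite hn in K; rewrite E; apply K.
      * apply finite_adjoin, finite_empty.
      * intros z hz; apply mem_adjoin in hz; rewrite mem_empty in hz; destruct hz as [[]| ->].
        apply (merge_omega G M hM), mem_omega; eauto.
      * exists (ofnat 0); apply mem_adjoin; auto.
Qed.

(** A finite set forgets order and repetition. With an enumeration [en s] fixed, a list over [s] is
    recovered from a list of positions, and there are only countably many lists of positions, so
    these join the index. *)
Lemma combine_list (I : Type) (cI : countable_type I) (G : I -> list V -> V) X : omega ⊆ X ->
  (forall i, closed_list (G i) X) ->
  exists f, closed_fin f X /\ forall M, closed_fin f M -> forall i, closed_list (G i) M.
Proof.
  intros hw H.
  pose (en s := epsilon (inhabits nil) (fun l : list V => forall y, y ∈ s <-> In y l)).
  assert (hen : forall s, finite_set s -> forall y, y ∈ s <-> In y (en s))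
    by (intros s fs; exact (epsilon_spec (inhabits nil) _ fs)).
  (* Positions out of range read as [ofnat 0], which may lie outside [s]; the test keeps such lists
     away from [G]. *)
  pose (F (ip : I * list nat) s := let l := map (fun j => nth j (en s) (ofnat 0)) (snd ip) in
     if excluded_middle_informative (forall x, In x l -> x ∈ s) then G (fst ip) l else ofnat 0).
  assert (Z : ofnat 0 ∈ X) by (apply hw, mem_omega; eauto).
  destruct (combine_fin (I * list nat) (countable_prod _ _ cI (countable_list _ countable_nat)) F X hw)
    as (f & f1 & f2).
  { intros [i p] s fs hs; unfold F; destruct (excluded_middle_informative _) as [h|h]; auto.
    apply H; intros x hx; apply hs, h, hx. }
  exists f; split; [exact f1 |]; intros M hM i l hl.
  destruct (set_of_list l) as (s & fs & hs).
  assert (K : exists p, map (fun j => nth j (en s) (ofnat 0)) p = l).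
  { assert (L : forall x, In x l -> In x (en s)) by (intros x hx; apply hen, hs; auto).
    clear - L; induction l as [|x l IH]; [exists nil; reflexivity |].
    destruct IH as [p hp]; [intros y hy; apply L; right; exact hy |].
    destruct (In_nth (en s) x (ofnat 0) (L x (or_introl eq_refl))) as (j & _ & hj).
    exists (j :: p); cbn [map]; rewrite hp, hj; reflexivity. }
  destruct K as [p hp].
  assert (J : F (i, p) s ∈ M).
  { apply f2; auto; intros y hy; apply hl, hs, hy. }
  unfold F in J; cbv zeta in J; cbn [fst snd] in J; rewrite hp in J.
  destruct (excluded_middle_informative _) as [h|h]; [exact J |].
  destruct h; intros x hx; apply hs, hx.
Qed.

(** The members of [S] with [P] form a nonstationary set, see [null_iff]. Using a predicate and a
    witnessing function avoids comprehension when properties are combined. *)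
Definition null (S : V) (P : V -> Prop) : Prop :=
  exists f, closed_fin f (union S) /\ forall M, M ∈ S -> closed_fin f M -> ~ P M.

Lemma null_iff S P : ~ stationary_in (union S) (sep S P) <-> null S P.
Proof.
  split.
  - intro h; apply NNPP; intro no; apply h; split.
    + intros M hM; apply mem_sep in hM; apply mem_power; intros y hy; apply mem_union.
      exists M; tauto.
    + intros f hf; apply NNPP; intro no'; apply no; exists f; split; [exact hf |].
      intros M hM cM PM; apply no'; exists M; split; [apply mem_sep; auto | exact cM].
  - intros (f & f1 & f2) [_ h]; destruct (h f f1) as (M & hM & cM).
    apply mem_sep in hM; exact (f2 M (proj1 hM) cM (proj2 hM)).
Qed.

Section Null.
Variable S : V.
Hypothesis omegaS : omega ⊆ union S.

Lemma null_list (I : Type) (cI : countable_type I) (G : I -> list V -> V) P :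
  (forall i, closed_list (G i) (union S)) ->
  (forall M, M ∈ S -> (forall i, closed_list (G i) M) -> ~ P M) -> null S P.
Proof.
  intros H K; destruct (combine_list I cI G _ omegaS H) as (f & f1 & f2).
  exists f; split; auto.
Qed.

Lemma null_mono (P Q : V -> Prop) : null S Q -> (forall M, M ∈ S -> P M -> Q M) -> null S P.
Proof. intros (f & f1 & f2) h; exists f; split; auto; intros M hM cM PM; exact (f2 M hM cM (h M hM PM)). Qed.

Lemma null_countable (I : Type) (cI : countable_type I) (P : I -> V -> Prop) :
  (forall i, null S (P i)) -> null S (fun M => exists i, P i M).
Proof.
  intro H.
  pose (F i := proj1_sig (constructive_indefinite_description _ (H i))).
  assert (hF : forall i, closed_fin (F i) (union S) /\ forall M, M ∈ S -> closed_fin (F i) M -> ~ P i M)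
    by exact (fun i => proj2_sig (constructive_indefinite_description _ (H i))).
  destruct (combine_fin I cI F _ omegaS (fun i => proj1 (hF i))) as (f & f1 & f2).
  exists f; split; auto; intros M hM cM [i hi]; exact (proj2 (hF i) M hM (f2 M cM i) hi).
Qed.

Lemma null_or (P Q : V -> Prop) : null S P -> null S Q -> null S (fun M => P M \/ Q M).
Proof.
  intros hP hQ; apply null_mono with (fun M => exists b : bool, (if b then P else Q) M).
  - apply null_countable.
    + exists (fun b : bool => if b then 0 else 1); intros [|] [|]; auto; discriminate.
    + intros [|]; auto.
  - intros M _ [h|h]; [exists true | exists false]; exact h.
Qed.

Lemma null_fine a : a ∈ union S -> null S (fun M => a ∉ M).
Proof.
  intro ha; exists (fun _ => a); split; [intros s _ _; exact ha |].
  intros M _ h k; apply k, (h empty finite_empty); intros y hy; apply mem_empty in hy; destruct hy.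
Qed.

(** The diagonal intersection is realized by making the index an argument: [a :: l] is sent to [F a]
    applied to the set of [l]. If [a ∈ M], closure under this one function gives closure under
    [F a]. Lists are used because a set would not show which element is the index. *)
Lemma null_normal (x : V) (P : V -> V -> Prop) : x ⊆ union S ->
  (forall a, a ∈ x -> null S (P a)) -> null S (fun M => exists a, a ∈ x /\ a ∈ M /\ P a M).
Proof.
  intros hx H.
  assert (C : forall a, exists f, closed_fin f (union S) /\
     (a ∈ x -> forall M, M ∈ S -> closed_fin f M -> ~ P a M)).
  { intro a; destruct (classic (a ∈ x)) as [h|h].
    - destruct (H a h) as (f & f1 & f2); exists f; auto.
    - exists (fun _ => ofnat 0); split; [| contradiction].
      intros s _ _; apply omegaS, mem_omega; eauto. }
  pose (F a := proj1_sig (constructive_indefinite_description _ (C a))).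
  assert (hF : forall a, closed_fin (F a) (union S) /\
     (a ∈ x -> forall M, M ∈ S -> closed_fin (F a) M -> ~ P a M))
    by exact (fun a => proj2_sig (constructive_indefinite_description _ (C a))).
  assert (toset : forall l : list V, {s : V | finite_set s /\ forall y, y ∈ s <-> In y l})
    by (intro l; apply constructive_indefinite_description, set_of_list).
  pose (G (_ : unit) l := match l with nil => ofnat 0 | a :: l => F a (proj1_sig (toset l)) end).
  apply (null_list unit) with (G := G).
  - exists (fun _ => 0); intros [] []; reflexivity.
  - intros u [|a l] hl; cbn; [apply omegaS, (mem_omega (ofnat 0)); exists 0; reflexivity |].
    apply (hF a); destruct (toset l) as (s & fs & hs); cbn; auto.
    intros y hy; apply hl; right; apply hs, hy.
  - intros M hM cM (a & ha & haM & PM); revert PM; apply (hF a); auto.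
    intros s [l hl] hs.
    assert (K : G tt (a :: l) ∈ M).
    { apply cM; intros y [<-|hy]; auto; apply hs, hl, hy. }
    cbn in K; destruct (toset l) as (s' & fs' & hs'); cbn in K.
    replace s with s'; [exact K |].
    apply set_ext; intro y; rewrite hs', hl; reflexivity.
Qed.
End Null.

(** * The generic ultrapower *)

Lemma stage_mono a b : b ⊆ a -> stage b ⊆ stage a.
Proof.
  intros h x hx; apply mem_stage in hx; destruct hx as (c & hc & hx); apply mem_stage; eauto.
Qed.

Lemma stage_cup a x y : ordinal a -> x ∈ stage a -> y ∈ stage a -> x ∪ y ∈ stage a.
Proof.
  intros oa hx hy; apply mem_stage in hx; apply mem_stage in hy; apply mem_stage.
  destruct hx as (b & hb & hx), hy as (c & hc & hy); exists (b ∪ c); split.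
  - destruct (ordinal_cup b c) as [->| ->]; auto; eapply ordinal_mem; eauto.
  - intros z hz; apply mem_cup in hz; destruct hz as [hz|hz];
      [apply (stage_mono _ b) | apply (stage_mono _ c)]; auto;
      intros w hw; apply mem_cup; auto.
Qed.

Lemma ordinal_sub_stage a : ordinal a -> a ⊆ stage a.
Proof.
  induction a as [a IH] using V_ind; intros oa b hb; apply mem_stage; exists b; split; auto.
  apply IH; auto; exact (ordinal_mem _ _ oa hb).
Qed.

Lemma cap_cap M x z : x ⊆ z -> (M ∩ z) ∩ x = M ∩ x.
Proof. intro h; apply set_ext; intro y; rewrite !mem_cap; intuition. Qed.

Lemma cap_sub M x : M ∩ x ⊆ x.
Proof. intros y hy; apply mem_cap in hy; tauto. Qed.

Lemma sub_cup_l x y : x ⊆ x ∪ y.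
Proof. intros z hz; apply mem_cup; auto. Qed.

Lemma sub_cup_r x y : y ⊆ x ∪ y.
Proof. intros z hz; apply mem_cup; auto. Qed.

Lemma aleph_omega_sub_stage : aleph_omega ⊆ stage aleph_omega.
Proof. apply ordinal_sub_stage, ordinal_aleph_omega. Qed.

Lemma empty_mem_stage : empty ∈ stage aleph_omega.
Proof. apply aleph_omega_sub_stage, (aleph_sub_omega 0), (ofnat_mem_aleph 0). Qed.

Section Forcing.
Variables (I : V -> V) (S : V).
Hypothesis statS : stationary S.
Hypothesis subS : stage aleph_omega ⊆ union S.
Hypothesis projS : forall x A, x ∈ stage aleph_omega -> A ⊆ power x ->
  (A ∈ I x <-> null S (fun M => M ∩ x ∈ A)).

Local Notation λ := aleph_omega.
Local Notation B := (tower_poset λ I).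
Local Notation coll := (collapses_to λ I).

Lemma omega_sub_union : omega ⊆ union S.
Proof. intros x hx; apply subS, aleph_omega_sub_stage, (aleph_sub_omega 0), hx. Qed.
Hint Resolve omega_sub_union : core.

Lemma aleph_omega_sub_union : aleph_omega ⊆ union S.
Proof. intros x hx; apply subS, aleph_omega_sub_stage, hx. Qed.

Lemma not_null_true : ~ null S (fun _ => True).
Proof.
  intros (f & f1 & f2); destruct (proj2 statS f f1) as (M & h1 & h2); exact (f2 M h1 h2 Logic.I).
Qed.

Lemma null_empty (P : V -> Prop) : (forall M, M ∈ S -> ~ P M) -> null S P.
Proof.
  intro h; exists (fun _ => ofnat 0); split; auto.
  intros s _ _; apply omega_sub_union, mem_omega; eauto.
Qed.

(** The condition read as a property of arbitrary [M], independent of its support; the forcing order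
    becomes inclusion modulo [null S]. *)
Definition pos (p : B) (M : V) : Prop := M ∩ fst (proj1_sig p) ∈ snd (proj1_sig p).

Lemma ple_iff (p q : B) : ple p q <-> null S (fun M => pos p M /\ ~ pos q M).
Proof.
  destruct p as [[c C] (h1 & h2 & h3)], q as [[d D] (k1 & k2 & k3)].
  unfold pos; cbn [ple tower_poset proj1_sig fst snd] in *; unfold tower_le; cbn [fst snd].
  rewrite projS.
  - split; intro h; (eapply null_mono; [exact h |]); intros M hM H; cbv beta in *.
    + apply mem_sep; split; [apply mem_power, cap_sub |].
      rewrite !cap_cap; auto using sub_cup_l, sub_cup_r.
    + apply mem_sep in H; rewrite !cap_cap in H; auto using sub_cup_l, sub_cup_r; tauto.
  - apply stage_cup; auto using ordinal_aleph_omega.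
  - intros y hy; apply mem_sep in hy; tauto.
Qed.

Lemma pos_not_null (p : B) : ~ null S (pos p).
Proof.
  destruct p as [[c C] (h1 & h2 & h3)]; intro h; apply h3; cbn [fst snd] in *.
  apply projS; auto.
Qed.

Lemma ple_refl (p : B) : ple p p.
Proof. apply ple_iff, null_empty; tauto. Qed.

Lemma ple_trans (p q r : B) : ple p q -> ple q r -> ple p r.
Proof.
  rewrite !ple_iff; intros h k; eapply null_mono.
  - exact (null_or _ omega_sub_union _ _ h k).
  - intros M _ [h1 h2]; cbv beta; destruct (classic (pos q M)); auto.
Qed.
Hint Resolve ple_refl : core.

(** Strengthening [p] by [Q] gives a condition only if [Q] depends on [M ∩ z] for some [z] in the
    tower; the new support is the union of [z] with the old one. *)
Lemma pos_refine (p : B) z (Q : V -> Prop) : z ∈ stage λ ->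
  (forall M, Q (M ∩ z) <-> Q M) -> ~ null S (fun M => pos p M /\ Q M) ->
  exists r : B, ple r p /\ forall M, pos r M <-> pos p M /\ Q M.
Proof.
  intros hz hQ hn; destruct p as [[c C] (h1 & h2 & h3)] eqn:E; cbn [fst snd] in *.
  pose (R := sep (power (c ∪ z)) (fun N => N ∩ c ∈ C /\ Q N)).
  assert (K : forall M, M ∩ (c ∪ z) ∈ R <-> M ∩ c ∈ C /\ Q M).
  { intro M; unfold R; rewrite mem_sep, mem_power, cap_cap by apply sub_cup_l.
    rewrite <- (hQ (M ∩ (c ∪ z))), cap_cap, hQ by apply sub_cup_r.
    pose proof (cap_sub M (c ∪ z)); tauto. }
  assert (T : tower_condition λ I (c ∪ z, R)).
  { assert (h : c ∪ z ∈ stage λ) by (apply stage_cup; auto using ordinal_aleph_omega).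
    assert (h' : R ⊆ power (c ∪ z)) by (intros y hy; apply mem_sep in hy; tauto).
    split; [exact h | split; [exact h' |]]; cbn [fst snd]; rewrite projS; auto.
    intro k; apply hn; eapply null_mono; [exact k |]; intros M _ H; apply K, H. }
  exists (exist _ (c ∪ z, R) T).
  assert (L : forall M, pos (exist _ (c ∪ z, R) T) M <-> M ∩ c ∈ C /\ Q M) by exact K.
  split; [| exact L]; apply ple_iff, null_empty; intros M _ [H1 H2]; apply H2.
  apply L in H1; exact (proj1 H1).
Qed.

Definition mono (phi : fprop B) : Prop := forall p q : B, ple q p -> phi p -> phi q.

Lemma mono_fnot (phi : fprop B) : mono (fnot phi).
Proof. intros p q h H r hr; apply H; eapply ple_trans; eauto. Qed.

Lemma mono_fand (phi psi : fprop B) : mono phi -> mono psi -> mono (fand phi psi).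
Proof. intros h k p q hq [H1 H2]; split; eauto. Qed.

Lemma mono_fall (T : Type) (F : T -> fprop B) : (forall t, mono (F t)) -> mono (fall F).
Proof. intros h p q hq H t; exact (h t p q hq (H t)). Qed.

Lemma fex_iff (T : Type) (F : T -> fprop B) (p : B) :
  fex F p <-> forall q : B, ple q p -> exists t (r : B), ple r q /\ F t r.
Proof.
  split.
  - intros H q hq; apply NNPP; intro no; apply (H q hq); intros t r hr hF; eauto 6.
  - intros H q hq K; destruct (H q hq) as (t & r & hr & hF); exact (K t r hr hF).
Qed.

Definition uev (f : ufun) (M : V) : V := uval f (M ∩ usupp f).

Lemma uev_cap f M z : usupp f ⊆ z -> uev f (M ∩ z) = uev f M.
Proof. intro h; unfold uev; rewrite cap_cap; auto. Qed.

(** Łoś's theorem for membership. *)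
Lemma umem_iff f g (p : B) : usupp f ∈ stage λ -> usupp g ∈ stage λ ->
  umem λ I f g p <-> null S (fun M => pos p M /\ uev f M ∉ uev g M).
Proof.
  intros hf hg; unfold umem, in_generic; pose (z := usupp f ∪ usupp g); fold z.
  pose (A := sep (power z) (fun M => uval f (M ∩ usupp f) ∈ uval g (M ∩ usupp g))); fold A.
  assert (hz : z ∈ stage λ) by (apply stage_cup; auto using ordinal_aleph_omega).
  assert (hA : forall M, M ∩ z ∈ A <-> uev f M ∈ uev g M).
  { intro M; unfold A; rewrite mem_sep, mem_power, !cap_cap by (unfold z; auto using sub_cup_l, sub_cup_r).
    pose proof (cap_sub M z); unfold uev; tauto. }
  rewrite fex_iff; split.
  - intro H; apply NNPP; intro no.
    destruct (pos_refine p z (fun M => uev f M ∉ uev g M) hz) as (r & hr & Hr); [| exact no |].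
    { intro M; rewrite !uev_cap by (unfold z; auto using sub_cup_l, sub_cup_r); reflexivity. }
    destruct (H r hr) as ([c Ec] & r' & hr' & Hc); cbn [proj1_sig] in Hc.
    (* The condition [r2] lies below [r], where membership fails, and below [(z, A)], where it
       holds, so it would be null. *)
    destruct (Hc r' (ple_refl r')) as (r2 & k1 & k2).
    assert (k3 := ple_trans _ _ _ k1 hr'); rewrite ple_iff in k2, k3.
    apply (pos_not_null r2); eapply null_mono.
    + exact (null_or _ omega_sub_union _ _ k2 k3).
    + intros M _ hM; cbv beta; destruct (classic (pos r M)) as [h|h]; [left | right; auto].
      split; [exact hM |]; unfold pos; rewrite Ec; cbn [fst snd]; rewrite hA.
      apply Hr in h; tauto.
  - intros H q hq.
    (* The truth set [A] contains [q] modulo a null set. It is therefore positive and can serve as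
       the condition that [in_generic] asks for. *)
    assert (T : tower_condition λ I (z, A)).
    { assert (hA' : A ⊆ power z) by (intros y hy; apply mem_sep in hy; tauto).
      split; [exact hz | split; [exact hA' |]]; cbn [fst snd]; rewrite projS; auto.
      intro k; rewrite ple_iff in hq; apply (pos_not_null q); eapply null_mono.
      - exact (null_or _ omega_sub_union _ _ (null_or _ omega_sub_union _ _ k hq) H).
      - intros M _ hM; cbv beta; rewrite hA.
        destruct (classic (pos p M)); destruct (classic (uev f M ∈ uev g M)); tauto. }
    exists (exist (fun c : B => proj1_sig c = (z, A)) (exist _ (z, A) T) eq_refl), q; split; [apply ple_refl |]; cbn [proj1_sig].
    intros q' hq'; exists q'; split; [apply ple_refl |].
    assert (k := ple_trans _ _ _ hq' hq); rewrite ple_iff in k |- *; eapply null_mono.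
    + exact (null_or _ omega_sub_union _ _ H k).
    + intros M _ [h1 h2]; unfold pos in h2 at 1; cbn [proj1_sig fst snd] in h2; rewrite hA in h2.
      cbv beta; destruct (classic (pos p M)); tauto.
Qed.

Lemma mono_coll a f : mono (coll a f).
Proof.
  rewrite collapses_toE; apply mono_fand; apply mono_fall; intro; apply mono_fnot.
Qed.

Lemma coll_iff a f (p : B) : coll a f p <->
  (forall b, b ∈ a -> forall q : B, ple q p -> exists g (r : B),
     ple r q /\ usupp g ∈ stage λ /\ umem λ I g f r /\ coll b g r) /\
  (forall g (q : B), ple q p -> usupp g ∈ stage λ -> umem λ I g f q ->
     exists b (r : B), b ∈ a /\ ple r q /\ coll b g r).
Proof.
  rewrite collapses_toE; split; intros [H1 H2]; split.
  - intros b hb q hq; pose proof (H1 (exist _ b hb)) as H; rewrite fex_iff in H.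
    destruct (H q hq) as (g & r & hr & h1 & h2 & h3); exists g, r; auto.
  - intros g q hq hg hm; apply NNPP; intro no; apply (H2 g q hq); split; [split; auto |].
    intros r hr K; rewrite fex_iff in K; destruct (K r (ple_refl r)) as ([b hb] & r' & hr' & h).
    apply no; exists b, r'; split; [exact hb | split; [eapply ple_trans; eauto | exact h]].
  - intros [b hb]; rewrite fex_iff; intros q hq; cbn [proj1_sig].
    destruct (H1 b hb q hq) as (g & r & h1 & h2 & h3 & h4); exists g, r; repeat split; auto.
  - intros g q hq [[hg hm] K]; destruct (H2 g q hq hg hm) as (b & r & hb & hr & h).
    apply (K r hr); rewrite fex_iff; intros q' hq'; exists (exist _ b hb), q'.
    split; [apply ple_refl | exact (mono_coll b g r q' hq' h)].
Qed.

(** Extensionality by induction: a member of either set is represented by some [g] below [f], and on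
    a stronger condition [g] also collapses to a member of the other set. *)
Lemma coll_unique a b f (p : B) : coll a f p -> coll b f p -> a = b.
Proof.
  revert b f p; induction a as [a IH] using V_ind.
  assert (K : forall b f (p : B), coll a f p -> coll b f p -> a ⊆ b).
  { intros b f p ha hb x hx; rewrite coll_iff in ha, hb; destruct ha as [ha _], hb as [_ hb].
    destruct (ha x hx p (ple_refl p)) as (g & r & h1 & h2 & h3 & h4).
    destruct (hb g r h1 h2 h3) as (y & r' & k1 & k2 & k3).
    rewrite (IH x hx y g r'); auto; exact (mono_coll _ _ _ _ k2 h4). }
  intros b f p ha hb; apply subset_antisym; [eauto |]; intros y hy.
  rewrite coll_iff in ha, hb; destruct ha as [_ ha], hb as [hb _].
  destruct (hb y hy p (ple_refl p)) as (g & r & h1 & h2 & h3 & h4).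
  destruct (ha g r h1 h2 h3) as (x & r' & k1 & k2 & k3).
  rewrite <- (IH x k1 y g r'); auto; exact (mono_coll _ _ _ _ k2 h4).
Qed.

Lemma coll_congr a f f' (p : B) : usupp f ∈ stage λ -> usupp f' ∈ stage λ ->
  null S (fun M => pos p M /\ uev f M <> uev f' M) -> coll a f p -> coll a f' p.
Proof.
  intros hf hf' E H.
  assert (C : forall g (r : B), ple r p -> usupp g ∈ stage λ ->
    umem λ I g f r <-> umem λ I g f' r).
  { intros g r hr hg; rewrite ple_iff in hr; rewrite !umem_iff by auto.
    assert (N := null_or _ omega_sub_union _ _ hr E).
    split; intro h; (eapply null_mono; [exact (null_or _ omega_sub_union _ _ N h) |]);
      intros M _ [h1 h2]; cbv beta;
      (destruct (classic (pos p M)); [| tauto]);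
      (destruct (classic (uev f M = uev f' M)) as [F|F]; [| tauto]); rewrite ?F in *; tauto. }
  rewrite coll_iff in *; destruct H as [H1 H2]; split.
  - intros b hb q hq; destruct (H1 b hb q hq) as (g & r & h1 & h2 & h3 & h4).
    exists g, r; repeat split; auto; apply C; auto; eapply ple_trans; eauto.
  - intros g q hq hg hm; apply (H2 g q hq hg), C; auto.
Qed.

(** In the generic ultrapower the ordinal [a] is represented by [M |-> otp (M ∩ a)]. *)
Definition otp_fun (a : V) : ufun := UFun a (fun N => mos N a).

Lemma uev_otp a M : ordinal a -> uev (otp_fun a) M = mos M a.
Proof. intro oa; apply mos_cap; auto; intros z hz; exact hz. Qed.

Lemma uev_jconst a M : uev (jconst a) M = a.
Proof. reflexivity. Qed.

(** For [b ∈ a], fineness puts [b] into almost every [M], so [mos M b ∈ mos M a]. Conversely a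
    function [g] below [otp_fun a] picks an element of [M ∩ a] whose collapse is its value;
    normality makes this element constant on a positive set, where [g] agrees with some
    [otp_fun b]. *)
Lemma coll_otp a (p : B) : a ∈ λ -> coll a (otp_fun a) p.
Proof.
  revert p; induction a as [a IH] using V_ind; intros p ha.
  assert (oa := ordinal_mem _ _ ordinal_aleph_omega ha).
  assert (L : forall b, b ∈ a -> b ∈ λ)
    by (intros b hb; exact (ordinal_trans _ _ _ ordinal_aleph_omega ha hb)).
  assert (sa : a ∈ stage λ) by (apply aleph_omega_sub_stage, ha).
  apply coll_iff; split.
  - intros b hb q hq; exists (otp_fun b), q; split; [apply ple_refl |].
    assert (sb : b ∈ stage λ) by (apply aleph_omega_sub_stage; auto).
    assert (ob := ordinal_mem _ _ oa hb).
    split; [exact sb | split; [| apply IH; auto]].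
    apply umem_iff; auto; eapply null_mono; [apply (null_fine S b); auto |].
    intros M _ [_ h2] hM; apply h2; rewrite !uev_otp by auto; apply mos_mem; auto.
  - intros g q hq hg hm; rewrite umem_iff in hm by auto.
    assert (K : exists b, b ∈ a /\
      ~ null S (fun M => pos q M /\ (b ∈ M /\ uev g M = mos M b))).
    { apply NNPP; intro no; apply (pos_not_null q).
      assert (N : null S (fun M => exists b, b ∈ a /\ b ∈ M /\
                     (pos q M /\ (b ∈ M /\ uev g M = mos M b)))).
      { apply null_normal; auto.
        - intros b hb; apply aleph_omega_sub_union; auto.
        - intros b hb; apply NNPP; intro no'; apply no; eauto. }
      eapply null_mono; [exact (null_or _ omega_sub_union _ _ hm N) |].
      intros M _ h; cbv beta; rewrite uev_otp by auto.
      destruct (classic (uev g M ∈ mos M a)) as [k|k]; [right | tauto].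
      apply mem_mos in k; auto; destruct k as (b & k1 & k2 & k3); exists b; tauto. }
    destruct K as (b & hb & K).
    assert (sb : b ∈ stage λ) by (apply aleph_omega_sub_stage; auto).
    assert (ob := ordinal_mem _ _ oa hb).
    (* The support needs [osucc b] rather than [b], because the property also asks whether
       [b ∈ M]. *)
    destruct (pos_refine q (usupp g ∪ osucc b) (fun M => b ∈ M /\ uev g M = mos M b)) as (r & hr & Hr).
    + apply stage_cup; auto using ordinal_aleph_omega.
      apply aleph_omega_sub_stage, osucc_mem_aleph_omega; auto.
    + intro M; rewrite uev_cap by apply sub_cup_l.
      rewrite mos_cap; auto.
      * rewrite mem_cap, mem_cup, mem_osucc; tauto.
      * intros z hz; apply mem_cup; right; apply mem_osucc; auto.
    + exact K.
    + exists b, r; split; [exact hb | split; [exact hr |]].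
      apply (coll_congr b (otp_fun b)); auto.
      apply null_empty; intros M _ [h1 h2]; apply h2; rewrite uev_otp by auto.
      apply Hr in h1; symmetry; tauto.
Qed.

Lemma mono_crit_seq n k : mono (crit_seq λ I n k).
Proof.
  destruct n; cbn [crit_seq]; [| apply mono_fnot].
  apply mono_fand; [| apply mono_fand].
  - intros p q _ h; exact h.
  - apply mono_fall; intro; apply mono_coll.
  - apply mono_fnot.
Qed.

(** [j(a) = b] holds iff [otp (M ∩ b) = a] almost everywhere. *)
Lemma j_eq_of_null a b (p : B) : b ∈ λ ->
  null S (fun M => mos M b <> a) -> j_eq λ I a b p.
Proof.
  intros hb h; assert (ob := ordinal_mem _ _ ordinal_aleph_omega hb).
  apply (coll_congr b (otp_fun b)).
  - apply aleph_omega_sub_stage, hb.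
  - exact empty_mem_stage.
  - eapply null_mono; [exact h |]; intros M _ [_ K]; rewrite uev_otp in K by auto; exact K.
  - apply coll_otp, hb.
Qed.

(** Otherwise [mos M b <> a] defines a condition; below it and a condition forcing [j(a) = b], one
    of the two strict inequalities holds on a positive set. There one of [jconst a] and [otp_fun b]
    is a member of the other although both collapse to [b], whence [b ∈ b]. *)
Lemma null_of_j_eq a b : ordinal a -> b ∈ λ ->
  (forall p : B, exists q : B, ple q p /\ j_eq λ I a b q) -> null S (fun M => mos M b <> a).
Proof.
  intros oa hb H; assert (ob := ordinal_mem _ _ ordinal_aleph_omega hb).
  assert (sb : b ∈ stage λ) by (apply aleph_omega_sub_stage, hb).
  apply NNPP; intro no.
  assert (T : tower_condition λ I (b, sep (power b) (fun N => mos N b <> a))).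
  { split; [exact sb | split].
    - intros y hy; apply mem_sep in hy; tauto.
    - cbn [fst snd]; rewrite projS; [| exact sb | intros y hy; apply mem_sep in hy; tauto].
      + intro h; apply no; eapply null_mono; [exact h |]; intros M _ K; cbv beta.
        rewrite mem_sep, mos_cap; auto; [| intros z hz; exact hz].
        split; [apply mem_power, cap_sub | exact K]. }
  destruct (H (exist _ _ T)) as (q & hq & hj).
  assert (D : forall M, pos (exist _ _ T : B) M -> mos M b <> a).
  { intros M hM; unfold pos in hM; cbn [proj1_sig fst snd] in hM; apply mem_sep in hM.
    rewrite mos_cap in hM; auto; [tauto | intros z hz; exact hz]. }
  rewrite ple_iff in hq; unfold j_eq in hj.
  assert (inv : forall M, mos (M ∩ b) b = mos M b).
  { intro M; apply mos_cap; auto; intros z hz; exact hz. }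
  destruct (classic (null S (fun M => pos q M /\ mos M b ∈ a))) as [N1|N1].
  - assert (N2 : ~ null S (fun M => pos q M /\ a ∈ mos M b)).
    { intro N2; apply (pos_not_null q); eapply null_mono;
        [exact (null_or _ omega_sub_union _ _ hq (null_or _ omega_sub_union _ _ N1 N2)) |].
      intros M _ hM; cbv beta; destruct (classic (pos (exist _ _ T : B) M)) as [h|h]; [| auto].
      apply D in h; destruct (ordinal_total (mos M b) a) as [k|[k|k]]; auto using ordinal_mos. }
    destruct (pos_refine q b (fun M => a ∈ mos M b)) as (r & hr & Hr); auto.
    { intro M; rewrite inv; reflexivity. }
    assert (C := coll_otp b r hb); rewrite coll_iff in C; destruct C as [_ C].
    destruct (C (jconst a) r (ple_refl r) empty_mem_stage) as (c & s & h1 & h2 & h3).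
    { apply umem_iff; auto using empty_mem_stage; apply null_empty; intros M _ [k1 k2].
      apply k2; rewrite uev_otp, uev_jconst by auto; apply Hr in k1; tauto. }
    assert (c = b); [| subst c; exact (mem_irrefl b h1)].
    apply (coll_unique _ _ (jconst a) s h3), (mono_coll _ _ q); auto; eapply ple_trans; eauto.
  - destruct (pos_refine q b (fun M => mos M b ∈ a)) as (r & hr & Hr); auto.
    { intro M; rewrite inv; reflexivity. }
    assert (C := mono_coll _ _ q r hr hj); rewrite coll_iff in C; destruct C as [_ C].
    destruct (C (otp_fun b) r (ple_refl r) sb) as (c & s & h1 & h2 & h3).
    { apply umem_iff; auto using empty_mem_stage; apply null_empty; intros M _ [k1 k2].
      apply k2; rewrite uev_otp, uev_jconst by auto; apply Hr in k1; tauto. }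
    assert (c = b); [| subst c; exact (mem_irrefl b h1)].
    apply (coll_unique _ _ (otp_fun b) s h3), coll_otp, hb.
Qed.

(** Of two distinct critical points the smaller would be fixed, being below the larger, and also
    moved. Later terms follow from uniqueness of collapses. *)
Lemma crit_seq_unique n k k' (p : B) :
  crit_seq λ I n k p -> crit_seq λ I n k' p -> k = k'.
Proof.
  revert k k' p; induction n as [|n IH]; intros k k' p h h'.
  - destruct h as (o & h1 & h2), h' as (o' & h1' & h2').
    destruct (ordinal_total k k' o o') as [e|[e|e]]; auto; exfalso.
    + exact (h2 p (ple_refl p) (h1' (exist _ k e))).
    + exact (h2' p (ple_refl p) (h1 (exist _ k' e))).
  - cbn [crit_seq] in h, h'; rewrite fex_iff in h, h'.
    destruct (h p (ple_refl p)) as (a & q & hq & c1 & j1).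
    destruct (h' q hq) as (a' & q' & hq' & c2 & j2).
    assert (a = a') by (apply (IH a a' q'); auto; exact (mono_crit_seq _ _ _ _ hq' c1)).
    subst a'; apply (coll_unique _ _ (jconst a) q'); [| exact j2].
    exact (mono_coll _ _ _ _ hq' j1).
Qed.

Lemma trivial_condition : exists p : B, forall M, pos p M.
Proof.
  assert (T : tower_condition λ I (empty, power empty)).
  { split; [exact empty_mem_stage | split; [intros y hy; exact hy |]]; cbn [fst snd].
    rewrite projS; [| exact empty_mem_stage | intros y hy; exact hy].
    intro h; apply not_null_true; eapply null_mono; [exact h |]; intros M _ _.
    apply mem_power, cap_sub. }
  exists (exist _ _ T); intro M; apply mem_power, cap_sub.
Qed.

Lemma null_of_not_j_eq a : a ∈ λ -> (forall p : B, ~ j_eq λ I a a p) ->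
  null S (fun M => mos M a = a).
Proof.
  intros ha H; apply NNPP; intro no; destruct trivial_condition as [p hp].
  assert (oa := ordinal_mem _ _ ordinal_aleph_omega ha).
  assert (sa : a ∈ stage λ) by (apply aleph_omega_sub_stage, ha).
  destruct (pos_refine p a (fun M => mos M a = a)) as (r & _ & Hr); [exact sa | | |].
  { intro M; rewrite mos_cap; [reflexivity | exact oa | intros z hz; exact hz]. }
  { intro h; apply no; eapply null_mono; [exact h |]; intros M _ E; exact (conj (hp M) E). }
  apply (H r), (coll_congr a (otp_fun a)); auto using empty_mem_stage, coll_otp.
  apply null_empty; intros M _ [h1 h2]; apply h2; rewrite uev_otp by auto.
  apply Hr in h1; tauto.
Qed.
End Forcing.

(** * From a tower to the Jonsson property *)

Fixpoint fin_nat k (i : Fin.t k) : nat :=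
  match i with Fin.F1 => 0 | Fin.FS i => S (fin_nat _ i) end.

Fixpoint fin_list (A : Type) k : (Fin.t k -> A) -> list A :=
  match k with
  | 0 => fun _ => nil
  | S k => fun v => v Fin.F1 :: fin_list A k (fun i => v (Fin.FS i))
  end.

Lemma nth_fin_list A k (v : Fin.t k -> A) d i : nth (fin_nat k i) (fin_list A k v) d = v i.
Proof. induction i as [k|k i IH]; cbn; [reflexivity | apply (IH (fun i => v (Fin.FS i)))]. Qed.

Lemma in_fin_list A k (v : Fin.t k -> A) x : In x (fin_list A k v) -> exists i, x = v i.
Proof.
  induction k as [|k IH]; cbn; [tauto |]; intros [<-|h]; [eauto |].
  destruct (IH (fun i => v (Fin.FS i)) h) as [i hi]; eauto.
Qed.

Lemma fin_list_inj A k (v w : Fin.t k -> A) : fin_list A k v = fin_list A k w -> v = w.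
Proof.
  intro E; apply functional_extensionality; intro i.
  rewrite <- (nth_fin_list _ _ v (v i) i), E; apply nth_fin_list.
Qed.

Lemma fin_bound k (P : Fin.t k -> nat -> Prop) :
  (forall i r r', r <= r' -> P i r -> P i r') -> (forall i, exists r, P i r) ->
  exists r, forall i, P i r.
Proof.
  intros m H; induction k as [|k IH].
  - exists 0; intro i; inversion i.
  - destruct (IH (fun i => P (Fin.FS i)) (fun i => m (Fin.FS i)) (fun i => H (Fin.FS i))) as [r hr].
    destruct (H Fin.F1) as [r' hr']; exists (max r r'); intro i.
    apply (Fin.caseS' i (fun i => P i _)); [| intro j]; [exact (m Fin.F1 _ _ (Nat.le_max_r r r') hr') | exact (m (Fin.FS j) _ _ (Nat.le_max_l r r') (hr j))].
Qed.

Section Countability.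
Variables (L : language).

Lemma countable_term : countable_type (fsym L) -> countable_type (term L).
Proof.
  intros [c hc].
  pose (code := fix code (t : term L) : nat := match t with
    | Var _ n => to_nat (0, n)
    | @App _ f args => to_nat (S (c f), list_code (fin_list nat _ (fun i => code (args i)))) end).
  exists code; induction x as [n|f args IH]; intros [m|g args'] E;
    apply to_nat_inj in E; try discriminate.
  - congruence.
  - injection E as E E'; apply hc in E; subst g; f_equal.
    apply list_code_inj, fin_list_inj in E'; apply functional_extensionality; intro i.
    apply IH; exact (f_equal (fun v => v i) E').
Qed.

Lemma countable_formula : countable_language L -> countable_type (formula L).
Proof.
  intros [cF [c hc]]; destruct (countable_term cF) as [d hd].
  pose (code := fix code (p : formula L) : nat := match p with
    | Equal t u => to_nat (0, to_nat (d t, d u))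
    | @Rel _ r args => to_nat (1, to_nat (c r, list_code (fin_list nat _ (fun i => d (args i)))))
    | Bot _ => to_nat (2, 0)
    | Imp p q => to_nat (3, to_nat (code p, code q))
    | All n p => to_nat (4, to_nat (n, code p)) end).
  exists code; induction x as [t u|r args| |p IHp q IHq|n p IHp];
    intros [t' u'|r' args'| |p' q'|n' p'] E;
    apply to_nat_inj in E; try discriminate; apply (f_equal snd) in E; cbn [snd] in E;
    try reflexivity; apply to_nat_inj in E; injection E as E1 E2.
  - f_equal; auto.
  - apply hc in E1; subst r'; f_equal.
    apply list_code_inj, fin_list_inj in E2; apply functional_extensionality; intro i.
    apply hd; exact (f_equal (fun v => v i) E2).
  - f_equal; auto.
  - f_equal; auto.
Qed.
End Countability.

Lemma sig_eq (A : Type) (P : A -> Prop) (x y : {a | P a}) : proj1_sig x = proj1_sig y -> x = y.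
Proof.
  destruct x as [x hx], y as [y hy]; cbn; intro E; subst y; f_equal; apply proof_irrelevance.
Qed.

Section Dependence.
Variables (L : language) (D : Type) (M : structure L D).

Lemma eval_dep (t : term L) : exists r, forall s s' : nat -> D,
  (forall j, j < r -> s j = s' j) -> eval M s t = eval M s' t.
Proof.
  induction t as [n|f args IH].
  - exists (S n); intros s s' H; apply H; lia.
  - apply fin_bound in IH.
    + destruct IH as [r hr]; exists r; intros s s' H; cbn [eval]; f_equal.
      apply functional_extensionality; intro i; apply hr, H.
    + intros i r r' h H s s' H'; apply H; intros j hj; apply H'; lia.
Qed.

(** Truth depends on finitely many variables, so an assignment can be replaced by a finite list, the
    kind of argument that Skolem functions take in [closed_list]. *)
Lemma sat_dep (p : formula L) : exists r, forall s s' : nat -> D,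
  (forall j, j < r -> s j = s' j) -> (sat M s p <-> sat M s' p).
Proof.
  induction p as [t u|r args| |p [r1 IHp] q [r2 IHq]|n p [r IHp]].
  - destruct (eval_dep t) as [r1 h1], (eval_dep u) as [r2 h2]; exists (max r1 r2).
    intros s s' H; cbn [sat]; rewrite (h1 s s'), (h2 s s'); [reflexivity | |];
      intros j hj; apply H; lia.
  - destruct (fin_bound _ (fun i r => forall s s' : nat -> D,
      (forall j, j < r -> s j = s' j) -> eval M s (args i) = eval M s' (args i))) as [k hk].
    + intros i r1 r2 h H s s' H'; apply H; intros j hj; apply H'; lia.
    + intro i; apply eval_dep.
    + exists k; intros s s' H; cbn [sat].
      replace (fun i => eval M s (args i)) with (fun i => eval M s' (args i)); [reflexivity |].
      apply functional_extensionality; intro i; symmetry; apply hk, H.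
  - exists 0; reflexivity.
  - exists (max r1 r2); intros s s' H; cbn [sat].
    rewrite (IHp s s'), (IHq s s'); [reflexivity | |]; intros j hj; apply H; lia.
  - exists r; intros s s' H; cbn [sat].
    split; intros K d; [rewrite <- (IHp (update s n d)) | rewrite (IHp _ (update s' n d))]; auto;
      intros j hj; unfold update; destruct (Nat.eqb j n); auto.
Qed.
End Dependence.

(** * Skolem functions and elementarity *)

Section Skolem.
Variables (k : V) (d0 : Elt k) (L : language) (M : structure L (Elt k)).

Definition to_elt (x : V) : Elt k :=
  match excluded_middle_informative (x ∈ k) with left h => exist _ x h | right _ => d0 end.

Lemma to_elt_proj (d : Elt k) : to_elt (proj1_sig d) = d.
Proof.
  unfold to_elt; destruct (excluded_middle_informative _) as [h|h];
    [apply sig_eq; reflexivity | destruct h; exact (proj2_sig d)].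
Qed.

Definition env (l : list V) : nat -> Elt k := fun j => to_elt (nth j l empty).

(** For [(p, n)] the value is a counterexample to [All n p] when there is one. With [Imp], [Bot] and
    [All] as primitives, quantifiers call for witnesses in no other form. *)
Definition skolem (i : fsym L + formula L * nat) (l : list V) : V :=
  match i with
  | inl f => proj1_sig (fun_int M (fun j : Fin.t (farity f) => env l (fin_nat _ j)))
  | inr (p, n) => proj1_sig (epsilon (inhabits d0) (fun d => ~ sat M (update (env l) n d) p))
  end.

Lemma skolem_mem i l : skolem i l ∈ k.
Proof. destruct i as [f|[p n]]; cbn [skolem]; match goal with |- proj1_sig ?d ∈ _ => exact (proj2_sig d) end. Qed.

(** The Tarski-Vaught test: if a universal formula fails in the large structure, the Skolem function
    yields a counterexample inside [N]. *)
Lemma skolem_elementary (N : V) : (forall i, closed_list (skolem i) N) ->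
  elementary_substructure M (fun d => proj1_sig d ∈ N).
Proof.
  intro H.
  assert (C : closed_under M (fun d => proj1_sig d ∈ N)).
  { intros f v hv; pose (l := fin_list V _ (fun i => proj1_sig (v i))).
    assert (K : skolem (inl f) l ∈ N).
    { apply H; intros x hx; apply in_fin_list in hx; destruct hx as [i ->]; apply hv. }
    cbn [skolem] in K; replace (fun j => env l (fin_nat _ j)) with v in K; [exact K |].
    apply functional_extensionality; intro i; unfold env, l.
    rewrite (nth_fin_list _ _ (fun i => proj1_sig (v i))), to_elt_proj; reflexivity. }
  exists C.
  assert (E : forall t s, proj1_sig (eval (substructure C) s t) = eval M (fun n => proj1_sig (s n)) t).
  { induction t as [n|f args IH]; intro s; [reflexivity |]; cbn [eval].
    cbn [substructure fun_int proj1_sig]; f_equal.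
    apply functional_extensionality; intro i; apply IH. }
  assert (U : forall (s : nat -> {d : Elt k | proj1_sig d ∈ N}) n d,
    (fun m => proj1_sig (update s n d m)) = update (fun m => proj1_sig (s m)) n (proj1_sig d)).
  { intros s n d; apply functional_extensionality; intro j; unfold update.
    destruct (Nat.eqb j n); reflexivity. }
  induction phi as [t u|r args| |p IHp q IHq|n p IHp]; intro s; cbn [sat].
  - rewrite <- !E; split; [intros ->; reflexivity | apply sig_eq].
  - cbn [substructure rel_int].
    replace (fun i => proj1_sig (eval (substructure C) s (args i)))
      with (fun i => eval M (fun n => proj1_sig (s n)) (args i)); [reflexivity |].
    apply functional_extensionality; intro i; symmetry; apply E.
  - reflexivity.
  - rewrite IHp, IHq; reflexivity.
  - split; intro K.
    + apply NNPP; intro no; apply not_all_ex_not in no; destruct no as [d hd].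
      destruct (sat_dep L _ M p) as [r hr].
      pose (l := map (fun j => proj1_sig (proj1_sig (s j))) (seq 0 r)).
      assert (A : forall d j, j < r -> update (env l) n d j = update (fun m => proj1_sig (s m)) n d j).
      { intros d' j hj; unfold update; destruct (Nat.eqb j n); [reflexivity |].
        unfold env, l; rewrite nth_indep with (d' := proj1_sig (proj1_sig (s 0)))
          by (rewrite length_map, length_seq; exact hj).
        rewrite (map_nth (fun j => proj1_sig (proj1_sig (s j)))), seq_nth by exact hj.
        apply to_elt_proj. }
      assert (X : exists d, ~ sat M (update (env l) n d) p)
        by (exists d; rewrite (hr _ _ (A d)); exact hd).
      assert (Y := epsilon_spec (inhabits d0) _ X); cbv beta in Y.
      set (d' := epsilon _ _) in Y.
      assert (Z : proj1_sig d' ∈ N).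
      { apply (H (inr (p, n)) l); intros x hx; apply in_map_iff in hx.
        destruct hx as (j & <- & _); exact (proj2_sig (s j)). }
      apply Y; rewrite (hr _ _ (A d')).
      specialize (K (exist _ d' Z)); rewrite IHp, U in K; exact K.
    + intro d; rewrite IHp, U; apply K.
Qed.
End Skolem.

Lemma jonsson_of_tower (I : V -> V) : I3_tower aleph_omega I ->
  decides_crit_seq aleph_omega I -> canonical_projection_NS aleph_omega I -> jonsson aleph_omega.
Proof.
  intros (_ & _ & HI) [k hk] (S & statS & subS & projS').
  assert (projS : forall x A, x ∈ stage aleph_omega -> A ⊆ power x ->
    (A ∈ I x <-> null S (fun M => M ∩ x ∈ A))).
  { intros x A hx hA; rewrite <- null_iff; apply projS'; auto. }
  clear projS'; assert (wS := omega_sub_union S subS).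
  destruct (trivial_condition I S statS projS) as [p0 _].
  assert (kcrit : forall n p, crit_seq aleph_omega I n (k n) p) by (intros n p; exact (hk p n)).
  (* The I3 clauses supply terms of the critical sequence on stronger conditions. Uniqueness
     identifies them with the decided [k n], so that membership in [aleph_omega] and cofinality
     become facts about [k]. *)
  assert (uniq := fun n a p h => crit_seq_unique I S subS projS n a (k n) p h (kcrit n p)).
  assert (kmem : forall n, k n ∈ aleph_omega).
  { intro n; destruct (HI p0) as [H _]; specialize (H n).
    rewrite (fex_iff I) in H.
    destruct (H p0 (ple_refl I S subS projS p0)) as ([a ha] & r & _ & h); cbn in h.
    rewrite <- (uniq n a r h); exact ha. }
  assert (kcof : forall b, b ∈ aleph_omega -> exists n, b ⊆ k n).
  { intros b hb; destruct (HI p0) as [_ H]; specialize (H (exist _ b hb)).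
    rewrite (fex_iff I) in H.
    destruct (H p0 (ple_refl I S subS projS p0)) as (n & r & _ & h).
    rewrite (fex_iff I) in h.
    destruct (h r (ple_refl I S subS projS r)) as ([a ha] & r' & _ & h1 & h2); cbn in h1, h2.
    exists n; rewrite <- (uniq n a r' h1); exact h2. }
  assert (ko : forall n, ordinal (k n))
    by (intro n; exact (ordinal_mem _ _ ordinal_aleph_omega (kmem n))).
  assert (N1 : forall n, null S (fun M => mos M (k (Datatypes.S n)) <> k n)).
  { intro n; apply (null_of_j_eq I S subS projS); auto; intro p.
    assert (H := kcrit (Datatypes.S n) p); cbn [crit_seq] in H.
    rewrite (fex_iff I) in H.
    destruct (H p (ple_refl I S subS projS p)) as (a & q & hq & h1 & h2).
    rewrite (uniq n a q h1) in h2; eauto. }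
  assert (N2 : null S (fun M => mos M (k 0) = k 0)).
  { apply (null_of_not_j_eq I S statS subS projS); auto; intros p hp.
    destruct (kcrit 0 p) as (_ & _ & h); exact (h p (ple_refl I S subS projS p) hp). }
  intros L cL M.
  pose (d0 := exist _ (ofnat 0) (aleph_sub_omega 0 _ (ofnat_mem_aleph 0 0)) : Elt aleph_omega).
  assert (N3 : null S (fun X => ~ forall i, closed_list (skolem _ d0 L M i) X)).
  { apply null_list with (I := (fsym L + formula L * nat)%type) (G := skolem _ d0 L M); auto.
    - apply countable_sum; [exact (proj1 cL) |].
      apply countable_prod; [apply countable_formula, cL | exact countable_nat].
    - intros i l _; apply (aleph_omega_sub_union S subS), skolem_mem. }
  assert (W : exists X, X ∈ S /\ (forall n, mos X (k (Datatypes.S n)) = k n) /\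
    mos X (k 0) <> k 0 /\ forall i, closed_list (skolem _ d0 L M i) X).
  { apply NNPP; intro no; apply (not_null_true S statS).
    eapply null_mono; [exact (null_or _ wS _ _ (null_or _ wS _ _
      (null_countable _ wS _ countable_nat _ N1) N2) N3) |].
    intros X hX _; cbv beta; apply NNPP; intro no'; apply no; exists X.
    split; [exact hX | split; [| split; [tauto |]]].
    - intro n; apply NNPP; intro h; apply no'; eauto.
    - apply NNPP; tauto. }
  destruct W as (X & hX & h1 & h2 & h3).
  pose (N := sep aleph_omega (fun x => x ∈ X)).
  (* The order types of the intersections with [k (n+1)] are the [k n], which are cofinal in
     [aleph_omega]. *)
  assert (full : mos X aleph_omega = aleph_omega).
  { apply subset_antisym; [apply mos_sub, ordinal_aleph_omega |]; intros b hb.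
    destruct (kcof (osucc b) (osucc_mem_aleph_omega b hb)) as [n hn].
    assert (hb' : b ∈ mos X (k (Datatypes.S n))) by (rewrite h1; apply hn, mem_osucc; auto).
    revert hb'; apply mos_mono; auto using ordinal_aleph_omega.
    exact (proj1 ordinal_aleph_omega _ (kmem _)). }
  exists N; split; [| split; [| split]].
  - intros x hx; apply mem_sep in hx; tauto.
  - intro E; apply h2, mos_full; auto; intros x hx.
    assert (hx' : x ∈ N) by (rewrite E; exact (ordinal_trans _ _ _ ordinal_aleph_omega (kmem 0) hx)).
    apply mem_sep in hx'; tauto.
  - exists (mos X); split; [| split].
    + intros a ha; apply mem_sep in ha; rewrite <- full.
      apply mos_mem; try tauto; apply ordinal_aleph_omega.
    + intros a b ha hb; apply mem_sep in ha; apply mem_sep in hb.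
      apply mos_inj; try tauto; apply (ordinal_mem aleph_omega); try tauto; apply ordinal_aleph_omega.
    + intros b hb; rewrite <- full in hb; apply mem_mos in hb; [| apply ordinal_aleph_omega].
      destruct hb as (c & c1 & c2 & ->); exists c; split; auto; apply mem_sep; auto.
  - apply (skolem_elementary _ d0); intros i l hl; apply mem_sep; split; [apply skolem_mem |].
    apply h3; intros x hx; apply hl, mem_sep in hx; tauto.
Qed.

(** * The tower of a stationary set *)

(** The critical sequence that [M] induces: [M ∩ aleph (k 0)] is a proper initial
    segment and [M ∩ aleph (k (n+1))] has order type [aleph (k n)]. *)
Definition good (k : nat -> nat) (M : V) : Prop :=
  (forall n, k n < k (S n)) /\
  (forall a, a ∈ M -> a ∈ aleph (k 0) -> a ⊆ M) /\
  ~ aleph (k 0) ⊆ M /\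
  forall n, mos M (aleph (k (S n))) = aleph (k n).

Lemma stage_transitive a x : ordinal a -> x ∈ stage a -> x ⊆ stage a.
Proof.
  intros oa hx y hy; apply mem_stage in hx; destruct hx as (b & hb & hx).
  exact (stage_mono _ _ (proj1 oa b hb) _ (hx y hy)).
Qed.

Lemma aleph_omega_bounded n (f : V -> V) : (forall x, x ∈ ofnat n -> f x ∈ aleph_omega) ->
  exists m, forall x, x ∈ ofnat n -> f x ∈ aleph m.
Proof.
  induction n as [|n IH]; intro H.
  - exists 0; intros x hx; apply mem_empty in hx; destruct hx.
  - destruct IH as [m hm]; [intros x hx; apply H, mem_ofnat_S; auto |].
    assert (h : f (ofnat n) ∈ aleph_omega) by (apply H, mem_ofnat_S; auto).
    apply mem_aleph_omega in h; destruct h as [m' hm']; exists (max m m').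
    intros x hx; apply mem_ofnat_S in hx; destruct hx as [hx| ->].
    + apply (aleph_le m); [lia | auto].
    + apply (aleph_le m'); [lia | auto].
Qed.

Lemma cf_aleph_omega : is_cf aleph_omega omega.
Proof.
  split; [exact ordinal_aleph_omega | split; [exact ordinal_omega | split]].
  - pose (c x := epsilon (inhabits 0) (fun n => x = ofnat n)).
    assert (hc : forall n, c (ofnat n) = n).
    { intro n; symmetry; apply ofnat_inj.
      exact (epsilon_spec (inhabits 0) (fun j => ofnat n = ofnat j) (ex_intro _ n eq_refl)). }
    exists (fun x => aleph (c x)); split.
    + intros x _; apply aleph_mem_omega.
    + intros b hb; apply mem_aleph_omega in hb; destruct hb as [n hn].
      exists (ofnat n); split; [apply mem_omega; eauto |]; rewrite hc.
      exact (proj1 (ordinal_aleph n) b hn).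
  - intros a ha [f [f1 f2]]; apply mem_omega in ha; destruct ha as [n ->].
    destruct (aleph_omega_bounded n f f1) as [m hm].
    destruct (f2 (aleph m) (aleph_mem_omega m)) as (x & hx & hs).
    apply (mem_irrefl (f x)), hs, hm, hx.
Qed.

Section Tower.
Variables (S : V) (k : nat -> nat).
Hypothesis unionS : union S = stage aleph_omega.
Hypothesis statS : stationary S.
Hypothesis goodS : forall M, M ∈ S -> good k M.

Definition NS_tower (x : V) : V := sep (power (power x)) (fun A => null S (fun M => M ∩ x ∈ A)).

Local Notation I := NS_tower.

Lemma stage_sub_union : stage aleph_omega ⊆ union S.
Proof. rewrite unionS; intros x hx; exact hx. Qed.

Lemma NS_tower_iff x A : x ∈ stage aleph_omega -> A ⊆ power x ->
  (A ∈ I x <-> null S (fun M => M ∩ x ∈ A)).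
Proof. intros _ hA; unfold I; rewrite mem_sep, mem_power; tauto. Qed.

Lemma NS_tower_null x A : A ∈ I x -> A ⊆ power x /\ null S (fun M => M ∩ x ∈ A).
Proof. unfold I; rewrite mem_sep, mem_power; tauto. Qed.

Lemma tower_NS_tower : tower aleph_omega I.
Proof.
  assert (sS := stage_sub_union); assert (wS := omega_sub_union S sS).
  assert (memI : forall x A, A ⊆ power x -> null S (fun M => M ∩ x ∈ A) -> A ∈ I x)
    by (intros x A h1 h2; apply mem_sep; rewrite mem_power; auto).
  split; [exact ordinal_aleph_omega | split].
  - intros x hx; split; [split; [| split; [| split; [| split]]] | split; [| split]].
    + intros A hA; apply mem_sep in hA; tauto.
    + apply memI; [intros y hy; apply mem_empty in hy; destruct hy |].
      apply null_empty; auto; intros M _ h; apply mem_empty in h; exact h.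
    + intro h; apply NS_tower_null in h; apply (not_null_true S statS).
      eapply null_mono; [apply h |]; intros M _ _; apply mem_power, cap_sub.
    + intros A B hB h; apply NS_tower_null in hB; destruct hB as [h1 h2]; apply memI.
      * intros y hy; auto.
      * eapply null_mono; [exact h2 |]; intros M _ K; apply h, K.
    + intros A B hA hB; apply NS_tower_null in hA; apply NS_tower_null in hB.
      destruct hA as [h1 h2], hB as [h3 h4]; apply memI.
      * intros y hy; apply mem_cup in hy; destruct hy; auto.
      * eapply null_mono; [exact (null_or _ wS _ _ h2 h4) |].
        intros M _ K; apply mem_cup in K; exact K.
    + intros A hA; apply memI; [intros y hy; apply mem_sep in hy; tauto |].
      assert (hx' : x ⊆ union S).
      { rewrite unionS; apply stage_transitive; auto using ordinal_aleph_omega. }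
      eapply null_mono;
        [exact (null_normal S wS x (fun a M => M ∩ x ∈ A a) hx' (fun a ha => proj2 (NS_tower_null _ _ (hA a ha)))) |].
      intros M _ K; apply mem_sep in K; destruct K as (_ & a & h1 & h2).
      apply mem_cap in h1; exists a; tauto.
    + intros a ha; apply memI; [intros y hy; apply mem_sep in hy; tauto |].
      assert (ha' : a ∈ union S).
      { rewrite unionS; revert a ha; apply stage_transitive; auto using ordinal_aleph_omega. }
      eapply null_mono; [exact (null_fine S a ha') |].
      intros M _ K h; apply mem_sep in K; apply (proj2 K), mem_cap; auto.
    + intros A hA; apply memI.
      * intros y hy; apply mem_bigcup in hy; destruct hy as [n hn].
        apply (proj1 (NS_tower_null _ _ (hA n))), hn.
      * eapply null_mono; [exact (null_countable S wS _ countable_nat _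
          (fun n => proj2 (NS_tower_null _ _ (hA n)))) |].
        intros M _ K; apply mem_bigcup in K; exact K.
  - intros x y hx hy hxy A hA.
    assert (E : forall M, M ∩ y ∈ lift x y A <-> M ∩ x ∈ A).
    { intro M; unfold lift; rewrite mem_sep, mem_power, cap_cap by exact hxy.
      pose proof (cap_sub M y); tauto. }
    rewrite !NS_tower_iff; auto.
    + split; intro h; (eapply null_mono; [exact h |]); intros M _; apply E.
    + intros z hz; apply mem_sep in hz; tauto.
Qed.

Lemma crit_seq_NS_tower n p : crit_seq aleph_omega I n (aleph (k n)) p.
Proof.
  assert (sS := stage_sub_union); revert p; induction n as [|n IH]; intro p.
  - split; [exact (ordinal_aleph _) | split].
    + intros [a ha]; cbn [proj1_sig].
      assert (ha' := aleph_sub_omega _ _ ha).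
      apply (j_eq_of_null I S sS NS_tower_iff); auto.
      eapply null_mono; [apply (null_fine S a), (aleph_omega_sub_union S sS), ha' |].
      intros M hM K h; apply K, mos_full; [exact (ordinal_mem _ _ (ordinal_aleph _) ha) |].
      apply (goodS M hM); auto.
    (* For every [M ∈ S] the order type of [M ∩ aleph (k 0)] is below [aleph (k 0)]. Hence
       [otp_fun], which collapses to [aleph (k 0)], is a member of its image under [j]. *)
    + intros q _ h; unfold j_eq in h; rewrite (coll_iff I S sS NS_tower_iff) in h.
      destruct h as [_ h]; assert (hk := aleph_mem_omega (k 0)).
      assert (sk := aleph_omega_sub_stage _ hk).
      destruct (h (otp_fun (aleph (k 0))) q (ple_refl I S sS NS_tower_iff q) sk)
        as (b & r & h1 & h2 & h3).
      * apply (umem_iff I S sS NS_tower_iff); auto using empty_mem_stage.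
        apply null_empty; auto; intros M hM [_ K]; apply K.
        rewrite uev_otp, uev_jconst by apply ordinal_aleph.
        destruct (goodS M hM) as (_ & tr & ns & _).
        destruct (ordinal_sub_mem (mos M (aleph (k 0))) (aleph (k 0))) as [E|E];
          auto using ordinal_mos, ordinal_aleph.
        { apply mos_sub, ordinal_aleph. }
        (* If the order type were all of [aleph (k 0)], each [a] would be [mos M c] with [c ∈ M]; as
           [c ⊆ M], this is [c] itself, so [a ∈ M]. *)
        exfalso; apply ns; intros a ha; rewrite <- E in ha.
        apply mem_mos in ha; [| apply ordinal_aleph]; destruct ha as (c & c1 & c2 & ->).
        rewrite mos_full; auto; exact (ordinal_mem _ _ (ordinal_aleph _) c1).
      * assert (E : b = aleph (k 0)); [| subst b; exact (mem_irrefl _ h1)].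
        apply (coll_unique I S sS NS_tower_iff _ _ _ r h3).
        apply (coll_otp I S sS NS_tower_iff), hk.
  - cbn [crit_seq]; rewrite (fex_iff I); intros q _; exists (aleph (k n)), q.
    split; [exact (ple_refl I S sS NS_tower_iff q) | split].
    + exact (IH q).
    + apply (j_eq_of_null I S sS NS_tower_iff); [apply aleph_mem_omega |].
      apply null_empty; auto; intros M hM h; apply h, (goodS M hM).
Qed.

Lemma tower_of_good :
  I3_tower aleph_omega I /\ decides_crit_seq aleph_omega I /\ canonical_projection_NS aleph_omega I.
Proof.
  assert (sS := stage_sub_union).
  assert (kmono : forall n, k n < k (Datatypes.S n)).
  { destruct (proj2 statS (fun _ => ofnat 0)) as (M & hM & _).
    - intros s _ _; apply (omega_sub_union S sS), mem_omega; eauto.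
    - apply (goodS M hM). }
  assert (kge : forall n, n <= k n).
  { induction n as [|n IH]; [lia |]; specialize (kmono n); lia. }
  split; [split; [exact tower_NS_tower | split; [exact cf_aleph_omega |]] | split].
  - intro p; split.
    + intro n; apply (fex_iff I); intros q _.
      exists (exist _ (aleph (k n)) (aleph_mem_omega (k n))), q.
      split; [exact (ple_refl I S sS NS_tower_iff q) | apply crit_seq_NS_tower].
    + intros [b hb]; apply (fex_iff I); intros q _.
      apply mem_aleph_omega in hb as hb'; destruct hb' as [n hn]; exists n, q.
      split; [exact (ple_refl I S sS NS_tower_iff q) |].
      apply (fex_iff I); intros r _.
      exists (exist _ (aleph (k n)) (aleph_mem_omega (k n))), r.
      split; [exact (ple_refl I S sS NS_tower_iff r) |].
      split; [apply crit_seq_NS_tower |]; intros x hx; cbn [proj1_sig] in *.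
      apply (aleph_le n); [apply kge | exact (ordinal_trans _ _ _ (ordinal_aleph n) hn hx)].
  - exists (fun n => aleph (k n)); intros p n; apply crit_seq_NS_tower.
  - exists S; split; [exact statS | split; [exact sS |]]; intros x A hx hA.
    rewrite null_iff; apply NS_tower_iff; auto.
Qed.
End Tower.

(** * From the Jonsson property to a tower *)

(** The operations become the binary function symbols of a language, and a substructure is closed
    under them. *)
Lemma jonsson_closed (k : V) (J : Type) (op : J -> V -> V -> V) : jonsson k ->
  countable_type J -> (forall i a b, a ∈ k -> b ∈ k -> op i a b ∈ k) ->
  exists N, N ⊆ k /\ N <> k /\ equinumerous N k /\
    forall i a b, a ∈ N -> b ∈ N -> op i a b ∈ N.
Proof.
  intros jk cJ H.
  pose (L := @Language J (fun _ => 2) False (fun _ => 0)).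
  assert (cL : countable_language L).
  { split; [exact cJ | exists (fun _ => 0); intros []]. }
  pose (fi := fun (i : fsym L) (v : Fin.t 2 -> Elt k) =>
    exist (fun y => y ∈ k) (op i (proj1_sig (v Fin.F1)) (proj1_sig (v (Fin.FS Fin.F1))))
      (H i _ _ (proj2_sig (v Fin.F1)) (proj2_sig (v (Fin.FS Fin.F1)))) : Elt k).
  pose (M := @Structure L (Elt k) fi (fun r => match r with end)).
  destruct (jk L cL M) as (N & h1 & h2 & h3 & [C _]); exists N; repeat split; auto.
  intros i a b ha hb.
  pose (v := fun j : Fin.t 2 => Fin.caseS' j (fun _ => Elt k)
     (exist _ a (h1 a ha) : Elt k) (fun _ => exist _ b (h1 b hb))).
  apply (C i v); intro j; unfold v; apply (Fin.caseS' j); [exact ha | intro; exact hb].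
Qed.

Lemma least_nat (P : nat -> Prop) : (exists n, P n) -> exists n, P n /\ forall m, m < n -> ~ P m.
Proof.
  intros [n hn]; induction n as [n IH] using lt_wf_ind.
  destruct (classic (exists m, m < n /\ P m)) as [(m & h1 & h2)|no]; [eauto |].
  exists n; split; auto; intros m h1 h2; apply no; eauto.
Qed.

Lemma pairing_proj k : pairing k -> ofnat 0 ∈ k -> exists (P : V -> V -> V) (p1 p2 : V -> V),
  (forall a b, a ∈ k -> b ∈ k -> P a b ∈ k /\ p1 (P a b) = a /\ p2 (P a b) = b) /\
  forall v, p1 v ∈ k /\ p2 v ∈ k.
Proof.
  intros (P & P1 & P2) h0.
  assert (C : forall v, exists ab, fst ab ∈ k /\ snd ab ∈ k /\
    ((exists a b, a ∈ k /\ b ∈ k /\ P a b = v) -> P (fst ab) (snd ab) = v)).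
  { intro v; destruct (classic (exists a b, a ∈ k /\ b ∈ k /\ P a b = v)) as [(a & b & ha & hb & E)|no].
    - exists (a, b); auto.
    - exists (ofnat 0, ofnat 0); split; [exact h0 | split; [exact h0 | contradiction]]. }
  pose (c v := proj1_sig (constructive_indefinite_description _ (C v))).
  assert (hc : forall v, fst (c v) ∈ k /\ snd (c v) ∈ k /\
    ((exists a b, a ∈ k /\ b ∈ k /\ P a b = v) -> P (fst (c v)) (snd (c v)) = v))
    by exact (fun v => proj2_sig (constructive_indefinite_description _ (C v))).
  exists P, (fun v => fst (c v)), (fun v => snd (c v)); split.
  - intros a b ha hb; split; [auto |]; destruct (hc (P a b)) as (h1 & h2 & h3).
    apply P2; auto; apply h3; eauto.
  - intro v; split; apply hc.
Qed.

(** The copy [Y] of the reals in [aleph_omega] has order type below [aleph_omega], since otherwise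
    its collapse would inject [aleph_omega] into the reals. The collapse thus fits into some
    [aleph m]; a sequence is coded as a real by its graph. *)
Lemma sequences_in_aleph : card_lt (power omega) aleph_omega ->
  exists m (c : V -> nat -> nat), forall k, exists a, a ∈ aleph m /\ c a = k.
Proof.
  intros [(f & f1 & f2) no].
  pose (Y := sep aleph_omega (fun y => exists r, r ∈ power omega /\ y = f r)).
  assert (oλ := ordinal_aleph_omega).
  assert (hY : forall r, r ∈ power omega -> f r ∈ Y) by (intros r hr; apply mem_sep; eauto).
  assert (hm : mos Y aleph_omega ∈ aleph_omega).
  { destruct (ordinal_sub_mem (mos Y aleph_omega) aleph_omega) as [E|E];
      auto using ordinal_mos, mos_sub.
    destruct no; apply injects_image with (f := fun r => mos Y (f r)).
    intros b hb; rewrite <- E in hb; apply mem_mos in hb; auto; destruct hb as (y & _ & hy & ->).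
    apply mem_sep in hy; destruct hy as (_ & r & hr & ->); eauto. }
  apply mem_aleph_omega in hm; destruct hm as [m hm].
  pose (code k := mkset (fun i : nat => ofnat (to_nat (i, k i)))).
  assert (hcode : forall k, code k ∈ power omega).
  { intro k; apply mem_power; intros x hx; apply mem_mkset in hx; destruct hx as [i ->].
    apply mem_omega; eauto. }
  assert (codeinj : forall k k', code k = code k' -> k = k').
  { intros k k' E; apply functional_extensionality; intro i.
    assert (h : ofnat (to_nat (i, k i)) ∈ code k') by (rewrite <- E; apply mem_mkset; eauto).
    apply mem_mkset in h; destruct h as [i' h]; apply ofnat_inj, to_nat_inj in h.
    injection h as h1 h2; congruence. }
  pose (E k := mos Y (f (code k))).
  assert (hE : forall k, E k ∈ aleph m).
  { intro k; apply (ordinal_trans _ _ _ (ordinal_aleph m) hm), mos_mem; auto. }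
  assert (Einj : forall k k', E k = E k' -> k = k').
  { intros k k' h; apply codeinj, f2; auto.
    revert h; apply mos_inj; auto; apply (ordinal_mem aleph_omega); auto. }
  exists m, (fun a => epsilon (inhabits (fun _ => 0)) (fun k => E k = a)); intro k.
  exists (E k); split; [apply hE |]; apply Einj.
  exact (epsilon_spec (inhabits (fun _ : nat => 0)) (fun k' => E k' = E k) (ex_intro _ k eq_refl)).
Qed.

(** Uniformly chosen injections of each [a ∈ aleph (S i)] into [aleph i], with inverses [einv]. In a
    set [M] closed under both, [aleph i ⊆ M] makes every such [a ∈ M] a subset of [M], and [M ∩ a]
    is never larger than [M ∩ aleph i]. *)
Definition einj (i : nat) (a b : V) : V :=
  if excluded_middle_informative (a ∈ aleph (S i) /\ b ∈ a)
  then the_inj a (aleph i) b else ofnat 0.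

Definition einv (i : nat) (a v : V) : V :=
  if excluded_middle_informative (a ∈ aleph (S i) /\ exists b, b ∈ a /\ einj i a b = v)
  then epsilon (inhabits empty) (fun b => b ∈ a /\ einj i a b = v) else ofnat 0.

Lemma einj_mem i a b : einj i a b ∈ aleph i.
Proof.
  unfold einj; destruct (excluded_middle_informative _) as [[h1 h2]|_]; [| apply ofnat_mem_aleph].
  apply mem_aleph_S in h1; apply the_inj_spec; tauto.
Qed.

Lemma einj_inj i a b c : a ∈ aleph (S i) -> b ∈ a -> c ∈ a -> einj i a b = einj i a c -> b = c.
Proof.
  intros ha hb hc; unfold einj.
  destruct (excluded_middle_informative _) as [_|no]; [| destruct no; auto].
  destruct (excluded_middle_informative _) as [_|no]; [| destruct no; auto].
  apply mem_aleph_S in ha; apply the_inj_spec; tauto.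
Qed.

Lemma einv_einj i a b : a ∈ aleph (S i) -> b ∈ a -> einv i a (einj i a b) = b.
Proof.
  intros ha hb; unfold einv; destruct (excluded_middle_informative _) as [h|no].
  - destruct (epsilon_spec (inhabits empty) _ (proj2 h)) as [h1 h2].
    apply (einj_inj i a); auto.
  - destruct no; eauto.
Qed.

Lemma einv_mem i a v : einv i a v ∈ aleph (S i).
Proof.
  unfold einv; destruct (excluded_middle_informative _) as [[h1 h2]|_]; [| apply ofnat_mem_aleph].
  destruct (epsilon_spec (inhabits empty) _ h2) as [h3 _].
  exact (ordinal_trans _ _ _ (ordinal_aleph _) h1 h3).
Qed.

(** * Order types of a closed set at the alephs *)

Section Analysis.
Variables (M : V) (n : nat).
Hypothesis M_einj : forall i a b, a ∈ M -> b ∈ M -> einj i a b ∈ M.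
Hypothesis M_einv : forall i a b, a ∈ M -> b ∈ M -> einv i a b ∈ M.
Hypothesis M_full : aleph n ⊆ M.

Lemma initial_segment a : a ∈ M -> a ∈ aleph (S n) -> a ⊆ M.
Proof.
  intros h1 h2 b hb; rewrite <- (einv_einj n a b h2 hb).
  apply M_einv; auto; apply M_full, einj_mem.
Qed.

Lemma injects_step i a k : a ∈ M -> a ∈ aleph (S i) -> injects (M ∩ aleph i) k -> injects (M ∩ a) k.
Proof.
  intros h1 h2; apply injects_trans; exists (einj i a); split.
  - intros b hb; apply mem_cap in hb; apply mem_cap; split; [| apply einj_mem].
    apply M_einj; tauto.
  - intros b c hb hc; apply mem_cap in hb; apply mem_cap in hc; apply einj_inj; tauto.
Qed.

Hypothesis M_missing : ~ aleph (S n) ⊆ M.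

(** At level [n] the set [M ∩ aleph (S n)] is an initial segment lying below any missing point. At
    the next level, each [a ∈ M] has [M ∩ a] no larger than the intersection one level down, so all
    proper initial segments of the order type stay below the preceding aleph. *)
Lemma mos_aleph_small i : n <= i -> mos M (aleph (S i)) ∈ aleph (S i).
Proof.
  induction 1 as [|i hi IH]; apply mem_aleph_S; split; auto using ordinal_mos.
  - assert (X : exists x, x ∈ aleph (S n) /\ x ∉ M).
    { apply NNPP; intro no; apply M_missing; intros x hx; apply NNPP; intro h; apply no; eauto. }
    destruct X as (x & hx & hxM); apply injects_mos; [apply ordinal_aleph |].
    apply injects_trans with x; [apply injects_sub | apply mem_aleph_S in hx; tauto].
    intros a ha; apply mem_cap in ha; destruct ha as [ha1 ha2].
    destruct (ordinal_total x a) as [h|[h|h]]; auto.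
    + exact (ordinal_mem _ _ (ordinal_aleph _) hx).
    + exact (ordinal_mem _ _ (ordinal_aleph _) ha2).
    + destruct hxM; exact (initial_segment a ha1 ha2 x h).
    + subst x; contradiction.
  - apply injects_sub; intros y hy; apply mem_mos in hy; [| apply ordinal_aleph].
    destruct hy as (a & h1 & h2 & ->); apply mem_aleph_S; split; [apply ordinal_mos |].
    apply injects_mos; [exact (ordinal_mem _ _ (ordinal_aleph _) h1) |].
    apply (injects_step (S i)); auto; apply mem_aleph_S in IH.
    eapply injects_trans; [apply injects_to_mos, ordinal_aleph | apply IH].
Qed.

Hypothesis M_big : mos M aleph_omega = aleph_omega.

(** Take the least [h] at which the order type reaches [aleph j]. One level down it is below
    [aleph j], hence of size at most the predecessor of [aleph j]; so is [M ∩ a] for every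
    [a ∈ M ∩ aleph h], and the order type cannot exceed [aleph j]. Here [j > n] ensures that
    [aleph j] is a successor and, through [mos_aleph_small], that [j < h]. *)
Lemma mos_aleph_hits j : n < j -> exists h, j < h /\ mos M (aleph h) = aleph j.
Proof.
  intro hj.
  assert (X : exists i, aleph j ⊆ mos M (aleph i)).
  { assert (h : aleph j ∈ mos M aleph_omega) by (rewrite M_big; apply aleph_mem_omega).
    apply mem_mos in h; [| exact ordinal_aleph_omega]; destruct h as (a & h1 & _ & E).
    apply mem_aleph_omega in h1; destruct h1 as [i hi]; exists i; rewrite E.
    apply mos_mono; [exact (ordinal_mem _ _ (ordinal_aleph _) hi) | apply ordinal_aleph |].
    exact (proj1 (ordinal_aleph i) a hi). }
  apply least_nat in X; destruct X as (h & h1 & h2).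
  assert (jh : j < h).
  { destruct (Nat.lt_ge_cases j h) as [H|H]; [exact H | exfalso].
    destruct (Nat.le_gt_cases h n) as [H'|H'].
    - apply (mem_irrefl (aleph h)), (mos_sub M _ (ordinal_aleph h)), h1, aleph_lt; lia.
    - destruct h as [|h]; [lia |].
      apply (mem_irrefl (mos M (aleph (S h)))), h1, (aleph_le (S h)); [lia |].
      apply mos_aleph_small; lia. }
  exists h; split; [exact jh |]; apply subset_antisym; [| exact h1].
  destruct h as [|h]; [lia |]; destruct j as [|j]; [lia |].
  assert (K : injects (M ∩ aleph h) (aleph j)).
  { apply injects_trans with (mos M (aleph h)); [apply injects_to_mos, ordinal_aleph |].
    apply mem_aleph_S; destruct (ordinal_total (mos M (aleph h)) (aleph (S j))) as [K|[K|K]];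
      auto using ordinal_mos, ordinal_aleph; exfalso; apply (h2 h); auto; intros x hx.
    - rewrite K; exact hx.
    - exact (ordinal_trans _ _ _ (ordinal_mos _ _) K hx). }
  intros y hy; apply mem_mos in hy; [| apply ordinal_aleph].
  destruct hy as (a & a1 & a2 & ->); apply mem_aleph_S; split; [apply ordinal_mos |].
  apply injects_mos; [exact (ordinal_mem _ _ (ordinal_aleph _) a1) |].
  apply (injects_step h); auto.
Qed.
End Analysis.

(** [hull_eval t a b] for [a ∈ N] and [b ∈ aleph m] are the elements of the hull
    of [N ∪ aleph m]; the two arguments code the leaves of [t] by pairing. *)
Inductive hull_op : Type := OEmpty | OAdjoin | OApply | OInj (i : nat) | OInv (i : nat).

Inductive hull_term : Type := TLeft | TRight | TOp (o : hull_op) (t u : hull_term).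

(** Operations of the structure on [aleph_omega] that yields [N]. Pairing merges the parameters of
    two terms into one, the constants put [omega] into [N], [BInj] and [BInv] make the preceding
    analysis apply to [N], and [BBound] controls the hull. *)
Inductive base_op : Type :=
  BPair | BNat (n : nat) | BInj (i : nat) | BInv (i : nat) | BBound (t : hull_term) (i : nat).

Lemma pair_eq (A B : Type) (a c : A) (b d : B) : (a, b) = (c, d) -> a = c /\ b = d.
Proof. intro E; split; [exact (f_equal fst E) | exact (f_equal snd E)]. Qed.

Lemma countable_hull_term : countable_type hull_term.
Proof.
  pose (co o := match o with OEmpty => to_nat (0, 0) | OAdjoin => to_nat (1, 0)
    | OApply => to_nat (2, 0) | OInj i => to_nat (3, i) | OInv i => to_nat (4, i) end).
  assert (hco : forall o o', co o = co o' -> o = o').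
  { intros [| | |i|i] [| | |i'|i'] E; apply to_nat_inj in E; congruence. }
  pose (c := fix c t := match t with TLeft => to_nat (0, 0) | TRight => to_nat (1, 0)
    | TOp o t u => to_nat (2, to_nat (co o, to_nat (c t, c u))) end).
  exists c; induction x as [| |o t IHt u IHu]; intros [| |o' t' u'] E;
    apply to_nat_inj in E; try discriminate; auto.
  destruct (pair_eq _ _ _ _ _ _ E) as [_ E1]; apply to_nat_inj, pair_eq in E1.
  destruct E1 as [E1 E2]; apply to_nat_inj, pair_eq in E2; destruct E2; f_equal; auto.
Qed.

Lemma countable_base_op : countable_type base_op.
Proof.
  apply countable_inj with (B := (nat * nat + hull_term * nat)%type) (f := fun o => match o with
    BPair => inl (0, 0) | BNat n => inl (1, n) | BInj i => inl (2, i) | BInv i => inl (3, i)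
    | BBound t i => inr (t, i) end).
  - intros [|i|i|i|t i] [|i'|i'|i'|t' i'] E; congruence.
  - auto using countable_sum, countable_prod, countable_nat, countable_hull_term.
Qed.

(** * Evaluation and bounds of hull terms *)

Section Hull.
Variables (G : V -> V -> V) (p1 p2 q1 q2 : V -> V).

Definition hull_opv (o : hull_op) : V -> V -> V :=
  match o with
  | OEmpty => fun _ _ => empty
  | OAdjoin => adjoin
  | OApply => G
  | OInj i => einj i
  | OInv i => einv i
  end.

Fixpoint hull_eval (t : hull_term) (a b : V) : V :=
  match t with
  | TLeft => a
  | TRight => b
  | TOp o t u => hull_opv o (hull_eval t (p1 a) (q1 b)) (hull_eval u (p2 a) (q2 b))
  end.

(** Independent of [b], hence an operation under which [N] alone can be closed. The test [m <= i] is
    what regularity of [aleph (S i)] asks for when [b] runs over [aleph m]. *)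
Definition hull_bound (m : nat) (t : hull_term) (i : nat) (a : V) : V :=
  if excluded_middle_informative (m <= i)
  then epsilon (inhabits empty) (fun d => d ∈ aleph (S i) /\
    forall b, b ∈ aleph m -> hull_eval t a b ∈ aleph (S i) -> hull_eval t a b ∈ d)
  else ofnat 0.

Lemma hull_bound_spec m t i a : m <= i -> hull_bound m t i a ∈ aleph (S i) /\
    forall b, b ∈ aleph m -> hull_eval t a b ∈ aleph (S i) -> hull_eval t a b ∈ hull_bound m t i a.
Proof.
  intro h; unfold hull_bound; destruct (excluded_middle_informative _) as [_|no]; [| contradiction].
  apply (epsilon_spec (inhabits empty) (fun d => d ∈ aleph (S i) /\
    forall b, b ∈ aleph m -> hull_eval t a b ∈ aleph (S i) -> hull_eval t a b ∈ d)).
  destruct (aleph_S_bounded i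
    (sep (aleph (S i)) (fun x => exists b, b ∈ aleph m /\ x = hull_eval t a b))) as (d & d1 & d2).
  - intros x hx; apply mem_sep in hx; tauto.
  - apply injects_trans with (aleph m); [| apply injects_sub, aleph_le, h].
    apply injects_image with (f := hull_eval t a); intros x hx; apply mem_sep in hx; tauto.
  - exists d; split; [exact d1 |]; intros b hb hx; apply d2, mem_sep; eauto.
Qed.

Definition base_opv (P : V -> V -> V) (m : nat) (o : base_op) : V -> V -> V :=
  match o with
  | BPair => P
  | BNat n => fun _ _ => ofnat n
  | BInj i => einj i
  | BInv i => einv i
  | BBound t i => fun a _ => hull_bound m t i a
  end.
End Hull.

Lemma adjoin_mem_stage a b : a ∈ stage aleph_omega -> b ∈ stage aleph_omega ->
  adjoin a b ∈ stage aleph_omega.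
Proof.
  intros ha hb; apply stage_cup; auto using ordinal_aleph_omega.
  apply mem_stage in hb; destruct hb as (y & hy & hb); apply mem_stage.
  exists (osucc y); split; [apply osucc_mem_aleph_omega, hy |].
  intros z hz; apply mem_mkset in hz; destruct hz as [_ ->]; apply mem_stage.
  exists y; split; [apply mem_osucc; auto | exact hb].
Qed.

(** An order type below [aleph_omega] would inject into some [aleph j], and [aleph (S j)] along with
    it. *)
Lemma mos_aleph_omega M : injects aleph_omega (M ∩ aleph_omega) ->
  mos M aleph_omega = aleph_omega.
Proof.
  intro H; assert (oλ := ordinal_aleph_omega).
  destruct (ordinal_sub_mem (mos M aleph_omega) aleph_omega) as [E|E];
    auto using ordinal_mos, mos_sub.
  apply mem_aleph_omega in E; destruct E as [j E]; apply aleph_sub_S, mem_aleph_S in E.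
  destruct (aleph_not_injects j).
  eapply injects_trans; [apply injects_sub, aleph_sub_omega |].
  eapply injects_trans; [exact H |].
  eapply injects_trans; [apply injects_to_mos; auto | apply E].
Qed.

(** Since [c] enumerates all sequences [k] along [aleph m ⊆ M], closure of [M]
    under the binary function [(a, s) |-> f (c a) s] gives closure under every
    [f k], in particular for the [k] that [M] induces. *)
Lemma good_of_jonsson (m : nat) (c : V -> nat -> nat) (f : (nat -> nat) -> V -> V) :
  jonsson aleph_omega -> (forall k, exists a, a ∈ aleph m /\ c a = k) ->
  (forall k, closed_fin (f k) (stage aleph_omega)) ->
  exists k M, M ⊆ stage aleph_omega /\ good k M /\ closed_fin (f k) M.
Proof.
  intros jon hc hf.
  pose (X := stage aleph_omega).
  assert (λX : forall n, aleph n ⊆ X).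
  { intros n x hx; apply aleph_omega_sub_stage, (aleph_sub_omega n), hx. }
  pose (G a s := if excluded_middle_informative (finite_set s /\ s ⊆ X) then f (c a) s else empty).
  destruct (pairing_proj _ pairing_aleph_omega (aleph_sub_omega 0 _ (ofnat_mem_aleph 0 0)))
    as (P & p1 & p2 & hP & hp).
  destruct (pairing_proj _ (pairing_aleph m) (ofnat_mem_aleph 0 m)) as (Q & q1 & q2 & hQ & hq).
  pose (ev := hull_eval G p1 p2 q1 q2).
  assert (emptyX : empty ∈ X) by exact empty_mem_stage.
  assert (opX : forall o a b, a ∈ X -> b ∈ X -> hull_opv G o a b ∈ X).
  { intros [| | |i|i] a b ha hb; cbn [hull_opv].
    - exact emptyX.
    - apply adjoin_mem_stage; auto.
    - unfold G; destruct (excluded_middle_informative _) as [[h1 h2]|_]; auto.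
      apply hf; auto.
    - apply (λX i), einj_mem.
    - apply (λX (S i)), einv_mem. }
  assert (evX : forall t a b, a ∈ aleph_omega -> b ∈ aleph m -> ev t a b ∈ X).
  { induction t as [| |o t IHt u IHu]; intros a b ha hb; cbn [ev hull_eval].
    - apply aleph_omega_sub_stage, ha.
    - apply (λX m), hb.
    - apply opX; [apply IHt | apply IHu]; first [apply hp | apply hq]. }
  destruct (jonsson_closed aleph_omega base_op (base_opv G p1 p2 q1 q2 P m) jon countable_base_op)
    as (N & N1 & N2 & N3 & N4).
  { intros [|n|i|i|t i] a b ha hb; cbn [base_opv].
    - apply hP; auto.
    - apply (aleph_sub_omega 0), ofnat_mem_aleph.
    - apply (aleph_sub_omega i), einj_mem.
    - apply (aleph_sub_omega (S i)), einv_mem.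
    - apply (aleph_sub_omega (S i)); destruct (le_dec m i) as [h|h].
      + exact (proj1 (hull_bound_spec G p1 p2 q1 q2 m t i a h)).
      + unfold hull_bound; destruct (excluded_middle_informative _); [contradiction |].
        apply ofnat_mem_aleph. }
  destruct N3 as (e & e1 & e2 & e3).
  assert (N0 : exists a0, a0 ∈ N).
  { destruct (e3 (ofnat 0) (aleph_sub_omega 0 _ (ofnat_mem_aleph 0 0))) as (a & ha & _); eauto. }
  destruct N0 as [a0 ha0].
  assert (Nω : aleph 0 ⊆ N).
  { intros x hx; apply mem_omega in hx; destruct hx as [n ->]; exact (N4 (BNat n) a0 a0 ha0 ha0). }
  (* The level is [max n m]: at least [n], the last aleph contained in [N], so that
     [mos_aleph_small] applies, and at least [m], so that [hull_bound] applies. *)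
  assert (Nbound : exists i d, m <= i /\ d ∈ aleph (S i) /\ forall x, x ∈ N ∩ aleph (S i) -> x ∈ d).
  { assert (ex : exists n, ~ aleph n ⊆ N).
    { apply NNPP; intro no; apply N2, subset_antisym; auto; intros x hx.
      apply mem_aleph_omega in hx; destruct hx as [n hn].
      apply NNPP; intro h; apply no; exists n; intro h'; auto. }
    apply least_nat in ex; destruct ex as (n & n1 & n2); destruct n as [|n]; [contradiction |].
    assert (small : mos N (aleph (S (max n m))) ∈ aleph (S (max n m))).
    { apply (mos_aleph_small N n); auto.
      - intros i a b; exact (N4 (BInj i) a b).
      - intros i a b; exact (N4 (BInv i) a b).
      - apply NNPP, n2; lia.
      - lia. }
    apply mem_aleph_S in small.
    destruct (aleph_S_bounded (max n m) (N ∩ aleph (S (max n m)))) as (d & d1 & d2).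
    - apply cap_sub.
    - eapply injects_trans; [apply injects_to_mos, ordinal_aleph | apply small].
    - exists (max n m), d; split; [lia | auto]. }
  destruct Nbound as (i & d & mi & d1 & d2).
  pose (M := sep X (fun x => exists t a b, a ∈ N /\ b ∈ aleph m /\ x = ev t a b)).
  assert (inM : forall t a b, a ∈ N -> b ∈ aleph m -> ev t a b ∈ M).
  { intros t a b ha hb; apply mem_sep; split; [apply evX; auto | exists t, a, b; auto]. }
  assert (Mop : forall o x y, x ∈ M -> y ∈ M -> hull_opv G o x y ∈ M).
  { intros o x y hx hy; apply mem_sep in hx; apply mem_sep in hy.
    destruct hx as (_ & t & a & b & ha & hb & ->), hy as (_ & u & a' & b' & ha' & hb' & ->).
    (* Pairing the parameters of [x] and [y] on both sides names the result of the operation by a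
       single term. *)
    assert (K := inM (TOp o t u) (P a a') (Q b b') (N4 BPair a a' ha ha') (proj1 (hQ b b' hb hb'))).
    cbn [ev hull_eval] in K.
    destruct (hP a a' (N1 _ ha) (N1 _ ha')) as (_ & E1 & E2), (hQ b b' hb hb') as (_ & E3 & E4).
    rewrite E1, E2, E3, E4 in K; exact K. }
  assert (NM : N ⊆ M) by (intros a ha; exact (inM TLeft a (ofnat 0) ha (ofnat_mem_aleph 0 m))).
  assert (mM : aleph m ⊆ M) by (intros b hb; exact (inM TRight a0 b ha0 hb)).
  (* If [d] were the value of [t] at [a] and [b], it would be below the bound computed from [a]; but
     this bound lies in [N ∩ aleph (S i)], hence below [d]. *)
  assert (dM : d ∉ M).
  { intro h; apply mem_sep in h; destruct h as (_ & t & a & b & ha & hb & E).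
    destruct (hull_bound_spec G p1 p2 q1 q2 m t i a mi) as [s1 s2].
    assert (K : hull_bound G p1 p2 q1 q2 m t i a ∈ d).
    { apply d2, mem_cap; split; [exact (N4 (BBound t i) a a ha ha) | exact s1]. }
    apply (mem_irrefl d); rewrite E at 1.
    apply (ordinal_trans d _ _ (ordinal_mem _ _ (ordinal_aleph _) d1) K), s2; auto.
    fold ev; rewrite <- E; exact d1. }
  assert (ex : exists n, ~ aleph n ⊆ M) by (exists (S i); intro h; apply dM, h, d1).
  (* This [n] is computed for [M] and may differ from the one for [N]; [aleph (S n)] becomes the
     first term of the critical sequence. *)
  apply least_nat in ex; destruct ex as (n & n1 & n2).
  destruct n as [|n]; [destruct n1; intros x hx; apply NM, Nω, hx |].
  assert (Mfull : aleph n ⊆ M) by (apply NNPP, n2; lia).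
  assert (Minj : forall i a b, a ∈ M -> b ∈ M -> einj i a b ∈ M) by (intro j; exact (Mop (OInj j))).
  assert (Minv : forall i a b, a ∈ M -> b ∈ M -> einv i a b ∈ M) by (intro j; exact (Mop (OInv j))).
  assert (Mbig : mos M aleph_omega = aleph_omega).
  { apply mos_aleph_omega, injects_trans with N.
    - apply injects_image with (f := e); intros b hb; destruct (e3 b hb) as (a & ha & E); eauto.
    - apply injects_sub; intros x hx; apply mem_cap; auto. }
  assert (hits : forall j, exists h, n < j -> j < h /\ mos M (aleph h) = aleph j).
  { intro j; destruct (classic (n < j)) as [hj|hj]; [| exists 0; contradiction].
    destruct (mos_aleph_hits M n Minj Minv Mfull n1 Mbig j hj) as [h hh]; exists h; auto. }
  pose (h j := proj1_sig (constructive_indefinite_description _ (hits j))).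
  assert (hh : forall j, n < j -> j < h j /\ mos M (aleph (h j)) = aleph j)
    by exact (fun j => proj2_sig (constructive_indefinite_description _ (hits j))).
  pose (k := fix k j := match j with 0 => S n | S j => h (k j) end).
  assert (hk : forall j, n < k j).
  { induction j as [|j IH]; cbn [k]; [lia |]; specialize (hh _ IH); lia. }
  exists k, M; split; [intros x hx; apply mem_sep in hx; tauto | split; [split; [| split; [| split]] |]].
  - intro j; apply (hh _ (hk j)).
  - intros a h1 h2; exact (initial_segment M n Minv Mfull a h1 h2).
  - exact n1.
  - intro j; apply (hh _ (hk j)).
  - intros s fs hs; destruct (hc k) as (a & ha & E).
    (* Finite subsets of [M] are elements of [M], by [OEmpty] and [OAdjoin], and so can be arguments
       of [OApply]. *)
    assert (sM : s ∈ M).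
    { destruct fs as [l hl]; revert s hl hs; induction l as [|x l IH]; intros s hl hs.
      - replace s with empty; [apply (Mop OEmpty a a); apply mM, ha |].
        apply set_ext; intro y; rewrite hl, mem_empty; reflexivity.
      - destruct (set_of_list l) as (t & _ & ht).
        replace s with (adjoin t x).
        + apply (Mop OAdjoin); [| apply hs, hl; left; reflexivity].
          apply IH; auto; intros y hy; apply hs, hl; right; apply ht, hy.
        + apply set_ext; intro y; rewrite mem_adjoin, hl, ht; cbn; intuition congruence. }
    assert (K := Mop OApply a s (mM a ha) sM); cbn [hull_opv] in K; unfold G in K.
    destruct (excluded_middle_informative _) as [_|no]; [rewrite E in K; exact K |].
    destruct no; split; auto; intros x hx; apply hs, mem_sep in hx; tauto.
Qed.

Lemma tower_of_jonsson : card_lt (power omega) aleph_omega -> jonsson aleph_omega ->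
  exists I : V -> V, I3_tower aleph_omega I /\ decides_crit_seq aleph_omega I /\
    canonical_projection_NS aleph_omega I.
Proof.
  intros hc jon; destruct (sequences_in_aleph hc) as (m & c & hm).
  pose (T k := sep (power (stage aleph_omega)) (good k)).
  assert (St : exists k, forall f, closed_fin f (stage aleph_omega) ->
    exists M, M ∈ T k /\ closed_fin f M).
  { apply NNPP; intro no.
    assert (C : forall k, exists f, closed_fin f (stage aleph_omega) /\
      forall M, M ∈ T k -> ~ closed_fin f M).
    { intro k; apply NNPP; intro no'; apply no; exists k; intros f hf.
      apply NNPP; intro no''; apply no'; exists f; split; auto.
      intros M h1 h2; apply no''; eauto. }
    pose (f k := proj1_sig (constructive_indefinite_description _ (C k))).
    assert (hf : forall k, closed_fin (f k) (stage aleph_omega) /\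
      forall M, M ∈ T k -> ~ closed_fin (f k) M)
      by exact (fun k => proj2_sig (constructive_indefinite_description _ (C k))).
    destruct (good_of_jonsson m c f jon hm (fun k => proj1 (hf k))) as (k & M & h1 & h2 & h3).
    apply (proj2 (hf k) M); auto; apply mem_sep; rewrite mem_power; auto. }
  destruct St as [k hk].
  assert (uT : union (T k) = stage aleph_omega).
  { apply subset_antisym; intros x hx.
    - apply mem_union in hx; destruct hx as (M & hM & hx); apply mem_sep in hM.
      destruct hM as [hM _]; apply mem_power in hM; auto.
    (* Closure under the constant function [x] puts [x] into a member of [T k]. *)
    - destruct (hk (fun _ => x)) as (M & h1 & h2); [intros s _ _; exact hx |].
      apply mem_union; exists M; split; [exact h1 |].
      apply (h2 empty finite_empty); intros y hy; apply mem_empty in hy; destruct hy. }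
  exists (NS_tower (T k)); apply (tower_of_good (T k) k uT).
  - split; [| rewrite uT; exact hk].
    intros M hM; apply mem_power; intros x hx; apply mem_union; eauto.
  - intros M hM; apply mem_sep in hM; tauto.
Qed.

Theorem theorem5p9 :
  (card_lt (power omega) aleph_omega ->
     (jonsson aleph_omega <->
      exists I : V -> V,
        I3_tower aleph_omega I /\
        decides_crit_seq aleph_omega I /\
        canonical_projection_NS aleph_omega I)) /\
  ((exists I : V -> V,
      I3_tower aleph_omega I /\
      decides_crit_seq aleph_omega I /\
      canonical_projection_NS aleph_omega I) ->
   jonsson aleph_omega).
Proof.
  assert (H : (exists I : V -> V, I3_tower aleph_omega I /\ decides_crit_seq aleph_omega I /\
      canonical_projection_NS aleph_omega I) -> jonsson aleph_omega).
  { intros (I & h1 & h2 & h3); exact (jonsson_of_tower I h1 h2 h3). }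
  split; [| exact H]; intro hc; split; [exact (tower_of_jonsson hc) | exact H].
Qed.
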